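(* Suppose $f(x,y)\in\mathcal{O}_2=\mathcal{O}_{\mathbb{C}^2,0}$ defines a reduced plane curve, let $\Phi=(\phi_1,\phi_2)$ be (parameterizations of) a pair of branches $B_1,B_2$ of a polar curve of $f$ defined by $\frac{\partial f}{\partial x}-a\frac{\partial f}{\partial y}=0$ ($a\in\mathbb{C}$), let $g\in\mathcal{O}_2$, and write $f_y=\partial f/\partial y$. Then $g_D\circ\Phi\in\Phi^*(J(f)_D)$ if and only if $i(g/f_y,B_1\cup B_2)\ge C(B_1,B_2)$, where the last inequality means that the order of vanishing of $$\frac{g\circ\phi_1}{f_y\circ\phi_1}-\frac{g\circ\phi_2}{f_y\circ\phi_2}$$ is greater than or equal to $C(B_1,B_2)$.
   Context: Branches of the polar curve are parameterized by giving $x$ as a fractional power series in $y$; for the pair of branches we use a common parameter $t$ and a common $y$-coordinate: $\phi_i(t)=(x_i(t),t^N)$, $i=1,2$, with $x_i\in\mathcal{O}_1=\mathbb{C}\{t\}$, $x_i(0)=0$, for a common integer $N\ge 1$. All orders are measured with respect to $t$. $C(B_1,B_2)$, the contact between the two branches, is the order of $x_1-x_2$. $J(f)=(\partial f/\partial x,\partial f/\partial y)$ is the Jacobian ideal. For $h\in\mathcal{O}_2$, $h_D=(h\circ p_1,h\circ p_2)$, where $p_1,p_2$ are the projections of $\mathbb{C}^2\times\mathbb{C}^2$ to its factors; so $h_D\circ\Phi=(h\circ\phi_1,h\circ\phi_2)$. $J(f)_D$ is the submodule of $\mathcal{O}^2_{\mathbb{C}^2\times\mathbb{C}^2,(0,0)}$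 generated by all $h_D$ with $h\in J(f)$, and $\Phi^*(J(f)_D)$ is the $\mathcal{O}_1$-submodule of $\mathcal{O}_1^2$ generated by the pullbacks of its elements by $\Phi$.
   Formalization: The right-hand condition also requires both quotients (g∘φ_i)/(f_y∘φ_i) to be holomorphic; without this ''if'' fails, e.g. f=x^3+y^3, a=1, φ_1=(t,t), φ_2=(-t,t), g=1, where the poles cancel. *)

(* Defs.v *)
From HB Require Import structures.
From mathcomp Require Import all_boot all_order all_algebra fraction ssrcomplements mpoly.
From mathcomp Require Import boolp reals constructive_ereal complex.

Set Implicit Arguments.
Unset Strict Implicit.
Unset Printing Implicit Defensive.

Import Order.TTheory GRing.Theory Num.Theory.
Local Open Scope ring_scope.

Record fps (K : Type) (n : nat) := Fps { fpscoef :> 'X_{1..n} -> K }.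

HB.instance Definition _ (K : Type) (n : nat) := gen_eqMixin (fps K n).
HB.instance Definition _ (K : Type) (n : nat) := gen_choiceMixin (fps K n).

Lemma fpsP (K : Type) (n : nat) (f g : fps K n) : (forall m, f m = g m) -> f = g.
Proof. by case: f g => [f] [g] /= h; congr Fps; exact/funext. Qed.

Section FpsRing.
Variables (K : comNzRingType) (n : nat).
Implicit Types (f g h : fps K n) (m : 'X_{1..n}).

Definition fps0 : fps K n := Fps (fun _ => 0).
Definition fps1 : fps K n := Fps (fun m => (m == 0%MM)%:R).
Definition fpsN f : fps K n := Fps (fun m => - f m).
Definition fpsD f g : fps K n := Fps (fun m => f m + g m).

(* Same formula as [mcoeffM]: the bound on k only makes the sum finite. *)
Definition fpsM f g : fps K n := Fps (fun m =>
  \sum_(k : 'X_{1..n < (mdeg m).+1, (mdeg m).+1} | m == (k.1 + k.2)%MM)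
    f k.1 * g k.2).
Arguments fpsM : simpl never.

Definition ftrunc (d : nat) f : {mpoly K[n]} :=
  \sum_(m : 'X_{1..n < d}) f m *: 'X_[m].

Lemma mcoeff_ftrunc d f m : (mdeg m < d)%N -> (ftrunc d f)@_m = f m.
Proof. by move=> lt; rewrite /ftrunc mcoeff_mpoly. Qed.

Lemma mcoeffM_eq (p p' q q' : {mpoly K[n]}) m :
    (forall k, (mdeg k <= mdeg m)%N -> p@_k = p'@_k) ->
    (forall k, (mdeg k <= mdeg m)%N -> q@_k = q'@_k) ->
  (p * q)@_m = (p' * q')@_m.
Proof.
move=> hp hq; rewrite !mcoeffM; apply: eq_bigr => k _.
by rewrite hp ?hq // -ltnS bmdeg.
Qed.

Lemma fpsME d f g m : (mdeg m < d)%N ->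
  fpsM f g m = (ftrunc d f * ftrunc d g)@_m.
Proof.
move=> lt; rewrite mcoeffM /=; apply: eq_bigr => k _.
by rewrite !mcoeff_ftrunc //; apply: leq_trans lt; exact: bmdeg.
Qed.

Fact fpsDA : associative fpsD.
Proof. by move=> f g h; apply: fpsP => m /=; rewrite addrA. Qed.
Fact fpsDC : commutative fpsD.
Proof. by move=> f g; apply: fpsP => m /=; rewrite addrC. Qed.
Fact fps0D : left_id fps0 fpsD.
Proof. by move=> f; apply: fpsP => m /=; rewrite add0r. Qed.
Fact fpsND : left_inverse fps0 fpsN fpsD.
Proof. by move=> f; apply: fpsP => m /=; rewrite addNr. Qed.

HB.instance Definition _ :=
  GRing.isZmodule.Build (fps K n) fpsDA fpsDC fps0D fpsND.

Fact fpsMC : commutative fpsM.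
Proof. by move=> f g; apply: fpsP => m; rewrite !(@fpsME (mdeg m).+1) // mulrC. Qed.

Lemma mcoeff_ftruncM d f g m : (mdeg m < d)%N ->
  (ftrunc d (fpsM f g))@_m = (ftrunc d f * ftrunc d g)@_m.
Proof. by move=> lt; rewrite mcoeff_ftrunc // (fpsME _ _ lt). Qed.

Fact fpsMA : associative fpsM.
Proof.
move=> f g h; apply: fpsP => m; rewrite !(@fpsME (mdeg m).+1) //.
pose F := ftrunc (mdeg m).+1.
transitivity (F f * (F g * F h))@_m.
  by apply: mcoeffM_eq => // k le; rewrite mcoeff_ftruncM.
by rewrite mulrA; apply: mcoeffM_eq => // k le; rewrite mcoeff_ftruncM.
Qed.

Fact fps1M : left_id fps1 fpsM.
Proof.
move=> f; apply: fpsP => m; rewrite (@fpsME (mdeg m).+1) //.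
rewrite -[RHS](@mcoeff_ftrunc (mdeg m).+1) // -[in RHS](mul1r (ftrunc _ f)).
by apply: mcoeffM_eq => // k le; rewrite mcoeff_ftrunc // mcoeff1.
Qed.

Fact fpsMDl : left_distributive fpsM fpsD.
Proof.
move=> f g h; apply: fpsP => m /=; rewrite -big_split /=.
by apply: eq_bigr => k _; rewrite mulrDl.
Qed.

Fact fps1_neq0 : fps1 != 0.
Proof.
apply/eqP => /(congr1 (fun f : fps K n => f 0%MM)) /= /eqP.
by rewrite eqxx oner_eq0.
Qed.

HB.instance Definition _ := GRing.Zmodule_isComNzRing.Build (fps K n)
  fpsMA fpsMC fps1M fpsMDl fps1_neq0.

Lemma fpscoefM f g m : (f * g) m =
  \sum_(k : 'X_{1..n < (mdeg m).+1, (mdeg m).+1} | m == (k.1 + k.2)%MM)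
    f k.1 * g k.2.
Proof. by []. Qed.

Lemma fpscoefD f g m : (f + g) m = f m + g m. Proof. by []. Qed.
Lemma fpscoefN f m : (- f) m = - f m. Proof. by []. Qed.
Lemma fpscoef0 m : (0 : fps K n) m = 0. Proof. by []. Qed.
Lemma fpscoef1 m : (1 : fps K n) m = (m == 0%MM)%:R. Proof. by []. Qed.

Definition fpsC (c : K) : fps K n := Fps (fun m => c *+ (m == 0%MM)).
Definition fpsX (i : 'I_n) : fps K n := Fps (fun m => (m == U_(i)%MM)%:R).

(* Same formula as [mcoeff_deriv]. *)
Definition fpsderiv (i : 'I_n) f : fps K n :=
  Fps (fun m => f (m + U_(i))%MM *+ (m i).+1).

End FpsRing.

Arguments fpsM {K n} f g : simpl never.

Section FpsSubst.
Variables (K : comNzRingType) (n k : nat).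

(* The substitution f(g_0, ..., g_(n-1)), defined when every g_i has zero
   constant term; a monomial of degree > mdeg m then contributes nothing to the
   coefficient of m. The value is 0 otherwise. *)
Definition fpssubst (f : fps K n) (g : n.-tuple (fps K k)) : fps K k :=
  if [forall i, tnth g i 0%MM == 0] then
    Fps (fun m => \sum_(e : 'X_{1..n < (mdeg m).+1})
                    f e * (\prod_(i < n) tnth g i ^+ e i) m)
  else 0.

End FpsSubst.

Section Convergence.
Variables (K : numFieldType) (n : nat).
Implicit Types (f g : fps K n).

Definition fpsnorm (s : K) (d : nat) f : K :=
  \sum_(m : 'X_{1..n < d}) `|f m| * s ^+ mdeg m.

(* Absolute convergence at (s, ..., s), i.e. on the closed polydisc of
   polyradius s: the partial sums are bounded. *)
Definition convergent f : Prop :=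
  exists s M : K, 0 < s /\ forall d, fpsnorm s d f <= M.

Lemma fpsnorm_ge0 s d f : 0 <= s -> 0 <= fpsnorm s d f.
Proof. by move=> s0; apply: sumr_ge0 => m _; rewrite mulr_ge0 ?exprn_ge0. Qed.

Lemma fpsnorm_mono s s' d f : 0 <= s -> s <= s' -> fpsnorm s d f <= fpsnorm s' d f.
Proof.
move=> s0 ss'; apply: ler_sum => m _; apply: ler_wpM2l => //.
by apply: lerXn2r => //; rewrite nnegrE // (le_trans s0).
Qed.

Lemma fpsnormN s d f : fpsnorm s d (- f) = fpsnorm s d f.
Proof. by apply: eq_bigr => m _; rewrite fpscoefN normrN. Qed.

Lemma fpsnormD s d f g : 0 <= s ->
  fpsnorm s d (f + g) <= fpsnorm s d f + fpsnorm s d g.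
Proof.
move=> s0; rewrite /fpsnorm -big_split /=; apply: ler_sum => m _.
by rewrite -mulrDl ler_wpM2r ?exprn_ge0 ?ler_normD.
Qed.

Lemma sum_bmonom_le (d : nat) (m0 : 'X_{1..n}) (c : K) : 0 <= c ->
  \sum_(m : 'X_{1..n < d} | (m : 'X_{1..n}) == m0) c <= c.
Proof.
move=> c0; case: (ltnP (mdeg m0) d) => h.
  by rewrite (big_pred1 (BMultinom h)) // => m /=; rewrite bmeqP.
rewrite big_pred0 // => m; apply/negbTE/eqP => e.
by move: (bmdeg m); rewrite e ltnNge h.
Qed.

Lemma fpsnormM s d f g : 0 <= s ->
  fpsnorm s d (f * g) <= fpsnorm s d f * fpsnorm s d g.
Proof.
move=> s0; pose t (k : 'X_{1..n < d, d}) : K :=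
  `|f k.1| * s ^+ mdeg k.1 * (`|g k.2| * s ^+ mdeg k.2).
have t0 k : 0 <= t k by rewrite !mulr_ge0 ?exprn_ge0.
have -> : fpsnorm s d f * fpsnorm s d g = \sum_k t k.
  rewrite /fpsnorm big_distrlr /= pair_bigA /=.
  by apply: eq_bigr.
apply: (@le_trans _ _ (\sum_(m : 'X_{1..n < d})
    \sum_(k : 'X_{1..n < d, d} | (m : 'X_{1..n}) == (k.1 + k.2)%MM) t k)).
  apply: ler_sum => m _.
  rewrite (fpsME _ _ (bmdeg m)) (mcoeff_poly_mul _ _ (bmdeg m)).
  apply: (@le_trans _ _ ((\sum_(k : 'X_{1..n < d, d} |
      (m : 'X_{1..n}) == (k.1 + k.2)%MM) `|f k.1 * g k.2|) * s ^+ mdeg m)).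
    rewrite ler_wpM2r ?exprn_ge0 //; apply: le_trans (ler_norm_sum _ _ _) _.
    apply: ler_sum => k _.
    by rewrite !mcoeff_ftrunc ?bmdeg.
  rewrite mulr_suml; apply: ler_sum => k /eqP ->.
  by rewrite mdegD exprD normrM /t mulrACA.
rewrite (exchange_big_dep xpredT) //=; apply: ler_sum => k _.
exact: sum_bmonom_le.
Qed.

Lemma fpsnorm1 s d : 0 <= s -> fpsnorm s d 1 <= 1.
Proof.
move=> s0; rewrite /fpsnorm (bigID (fun m : 'X_{1..n < d} => (m : 'X_{1..n}) == 0%MM)) /=.
rewrite addrC big1 ?add0r => [|m /negbTE m0]; last by rewrite m0 normr0 mul0r.
rewrite (eq_bigr (fun=> 1)) => [|m /eqP ->]; last first.
  by rewrite eqxx mdeg0 expr0 normr1 mulr1.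
exact: sum_bmonom_le.
Qed.

Lemma fpsnormX s d f r e : 0 <= s -> fpsnorm s d f <= r ->
  fpsnorm s d (f ^+ e) <= r ^+ e.
Proof.
move=> s0 fr; elim: e => [|e IHe]; first by rewrite !expr0 fpsnorm1.
rewrite !exprS; apply: le_trans (fpsnormM _ _ _ s0) _.
by rewrite ler_pM ?fpsnorm_ge0.
Qed.

Lemma fpsnorm_monom s d (p : nat) (g : p.-tuple (fps K n)) r (e : 'X_{1..p}) :
    0 <= s -> (forall i, fpsnorm s d (tnth g i) <= r) ->
  fpsnorm s d (\prod_(i < p) tnth g i ^+ e i) <= r ^+ mdeg e.
Proof.
move=> s0 gr; rewrite mdegE expr_sum.
apply: (@big_ind2 _ _ (fun (f : fps K n) (c : K) => fpsnorm s d f <= c)).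
- exact: fpsnorm1.
- move=> f1 c1 f2 c2 h1 h2; apply: le_trans (fpsnormM _ _ _ s0) _.
  by rewrite ler_pM ?fpsnorm_ge0.
- by move=> i _; apply: fpsnormX.
Qed.

Lemma convergent2 f g : convergent f -> convergent g ->
  exists s M : K, [/\ 0 < s, forall d, fpsnorm s d f <= M
                           & forall d, fpsnorm s d g <= M].
Proof.
move=> [s1 [M1 [s10 h1]]] [s2 [M2 [s20 h2]]].
have M10 : 0 <= M1 by apply: le_trans (h1 0%N); apply/fpsnorm_ge0/ltW.
have M20 : 0 <= M2 by apply: le_trans (h2 0%N); apply/fpsnorm_ge0/ltW.
have /orP[le|le] : (s1 <= s2) || (s2 <= s1).
- by by apply: real_leVge; apply: gtr0_real.
- exists s1, (M1 + M2); split => // d.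
    by apply: le_trans (h1 d) _; rewrite lerDl.
  apply: le_trans (fpsnorm_mono _ _ (ltW s10) le) _.
  by apply: le_trans (h2 d) _; rewrite lerDr.
- exists s2, (M1 + M2); split => // d.
    apply: le_trans (fpsnorm_mono _ _ (ltW s20) le) _.
    by apply: le_trans (h1 d) _; rewrite lerDl.
  by apply: le_trans (h2 d) _; rewrite lerDr.
Qed.

Lemma convergent1 : convergent 1.
Proof. by exists 1, 1; split => // d; apply: fpsnorm1. Qed.

Lemma convergentB f g : convergent f -> convergent g -> convergent (f - g).
Proof.
move=> cf cg; have [s [M [s0 hf hg]]] := convergent2 cf cg.
exists s, (M + M); split => // d.
apply: le_trans (fpsnormD _ _ _ (ltW s0)) _.
by rewrite fpsnormN lerD.
Qed.

Lemma convergentM f g : convergent f -> convergent g -> convergent (f * g).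
Proof.
move=> cf cg; have [s [M [s0 hf hg]]] := convergent2 cf cg.
exists s, (M * M); split => // d.
apply: le_trans (fpsnormM _ _ _ (ltW s0)) _.
by apply: ler_pM => //; apply/fpsnorm_ge0/ltW.
Qed.

Lemma convergent_monom (c : K) (m0 : 'X_{1..n}) :
  convergent (Fps (fun m => c *+ (m == m0))).
Proof.
exists 1, `|c|; split => // d.
rewrite /fpsnorm (bigID (fun m : 'X_{1..n < d} => (m : 'X_{1..n}) == m0)) /=.
rewrite addrC big1 ?add0r => [|m /negbTE ->]; last by rewrite normr0 mul0r.
rewrite (eq_bigr (fun=> `|c|)) => [|m ->]; last by rewrite expr1n mulr1.
exact: sum_bmonom_le.
Qed.

Lemma convergentC (c : K) : convergent (fpsC n c).
Proof. exact: convergent_monom. Qed.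

Lemma convergentX (i : 'I_n) : convergent (fpsX K i).
Proof. exact: convergent_monom. Qed.

Lemma convergent_deriv (i : 'I_n) f : convergent f -> convergent (fpsderiv i f).
Proof.
move=> [s [M [s0 h]]]; exists (s / 2), (s^-1 * M); split; first by rewrite divr_gt0.
move=> d; rewrite -(ler_pM2l s0) mulVKf ?gt_eqF //.
apply: le_trans (h d.+1); rewrite /fpsnorm mulr_sumr.
pose G (m : 'X_{1..n}) : K := `|f m| * s ^+ mdeg m.
have G0 m : 0 <= G m by apply: mulr_ge0 => //; apply/exprn_ge0/ltW.
apply: (@le_trans _ _ (\sum_(m : 'X_{1..n < d})
    \sum_(m' : 'X_{1..n < d.+1} | (m' : 'X_{1..n}) == (m + U_(i))%MM) G m')).
  apply: ler_sum => m _.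
  have lt : (mdeg (m + U_(i))%MM < d.+1)%N by rewrite mdegD mdeg1 addn1 ltnS bmdeg.
  rewrite (big_pred1 (BMultinom lt)) => [|m' /=]; last by rewrite bmeqP.
  have key : (m i).+1%:R * (s / 2) ^+ mdeg m <= s ^+ mdeg m.
    rewrite exprMn mulrCA ler_piMr ?exprn_ge0 //; first exact: ltW.
    rewrite exprVn ler_pdivrMr ?exprn_gt0 // mul1r -natrX ler_nat.
    apply: leq_trans (ltn_expl _ (ltnSn 1)) _.
    by rewrite leq_exp2l // mdegE (bigD1 i) //= leq_addr.
  rewrite /G /= normrMn mdegD mdeg1 addn1 exprS -[X in s * (X * _)]mulr_natr.
  rewrite -mulrA mulrCA ler_wpM2l //.
  by apply: ler_wpM2l => //; apply: ltW.
rewrite (exchange_big_dep xpredT) //=; apply: ler_sum => m' _.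
apply: le_trans (@sum_bmonom_le d (m' - U_(i))%MM (G m') (G0 m')).
rewrite big_mkcond [X in _ <= X]big_mkcond /=; apply: ler_sum => m _.
case: eqP => [->|_]; last by case: ifP.
by rewrite addmK eqxx.
Qed.

End Convergence.

Section ConvergentSubst.
Variables (K : numFieldType) (n k : nat).

(* If g has no constant term, its norm is made arbitrarily small by shrinking
   the polyradius. *)
Lemma fpsnorm_small (g : fps K k) (r s M : K) :
    g 0%MM = 0 -> 0 < r -> r <= 1 -> 0 < s -> (forall d, fpsnorm s d g <= M) ->
  forall d, fpsnorm (r * s) d g <= r * M.
Proof.
move=> g0 r0 r1 s0 h d; apply: le_trans (ler_wpM2l (ltW r0) (h d)).
rewrite /fpsnorm mulr_sumr; apply: ler_sum => m _.
have [->|/eqP m0] := eqVneq (m : 'X_{1..k}) 0%MM.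
  by rewrite g0 normr0 !mul0r mulr0.
rewrite mulrCA ler_wpM2l // exprMn; apply: ler_wpM2r; first exact/exprn_ge0/ltW.
have : (0 < mdeg m)%N by rewrite lt0n mdeg_eq0; apply/eqP.
case: (mdeg m) => // e _; rewrite exprS ler_piMr //; first exact: ltW.
by apply: exprn_ile1 => //; apply: ltW.
Qed.

Lemma convergent_tuple (p : nat) (g : 'I_p -> fps K k) :
    (forall i, convergent (g i)) ->
  exists s M : K, [/\ 0 < s, 0 <= M & forall i d, fpsnorm s d (g i) <= M].
Proof.
elim: p g => [|p IHp] g cg; first by exists 1, 0; split => // -[].
have [s [M [s0 M0 h]]] := IHp (fun i => g (lift ord0 i)) (fun i => cg _).
have [s' [M' [s'0 h']]] := cg ord0.
have M'0 : 0 <= M' by apply: le_trans (h' 0%N); apply/fpsnorm_ge0/ltW.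
pose t := s * s' / (s + s').
have ss0 : 0 < s + s' by rewrite addr_gt0.
have t0 : 0 < t by rewrite divr_gt0 ?mulr_gt0.
exists t, (M + M'); split; [by []|by rewrite addr_ge0|].
move=> i d; have [->|[j ->]] : i = ord0 \/ exists j, i = lift ord0 j.
  by case: (unliftP ord0 i) => [j ->|->]; [right; exists j|left].
- apply: (@le_trans _ _ M'); last by rewrite lerDr.
  apply: le_trans (h' d); apply: fpsnorm_mono; first exact: ltW.
  by rewrite ler_pdivrMr // mulrC ler_pM2l // lerDl; apply: ltW.
- apply: (@le_trans _ _ M); last by rewrite lerDl.
  apply: le_trans (h j d); apply: fpsnorm_mono; first exact: ltW.
  by rewrite ler_pdivrMr // ler_pM2l // lerDr; apply: ltW.
Qed.

Lemma convergent_subst (f : fps K n) (g : n.-tuple (fps K k)) :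
    convergent f -> (forall i, convergent (tnth g i)) ->
  convergent (fpssubst f g).
Proof.
move=> [r [M [r0 hf]]] cg; rewrite /fpssubst; case: forallP => [g0|_]; last first.
  exists 1, 0; split => // d; rewrite /fpsnorm big1 // => m _.
  by rewrite fpscoef0 normr0 mul0r.
have [s [A [s0 A0 hg]]] := convergent_tuple cg.
pose l := r / (r + A + 1).
have D0 : 0 < r + A + 1 by rewrite ltr_wpDl // addr_ge0 //; apply: ltW.
have l0 : 0 < l by rewrite divr_gt0.
have l1 : l <= 1 by rewrite ler_pdivrMr // mul1r -addrA lerDl addr_ge0.
have lA : l * A <= r.
  rewrite mulrAC ler_pdivrMr // ler_pM2l // -addrA addrCA lerDl.
  by rewrite addr_ge0 //; apply: ltW.
have ls0 : 0 <= l * s by apply: ltW; rewrite mulr_gt0.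
have hg' i d : fpsnorm (l * s) d (tnth g i) <= r.
  by apply: le_trans lA; apply: fpsnorm_small => //; apply/eqP.
exists (l * s), M; split; [by rewrite mulr_gt0|move=> d].
pose P (e : 'X_{1..n}) : fps K k := \prod_(i < n) tnth g i ^+ e i.
apply: (@le_trans _ _ (\sum_(e : 'X_{1..n < d}) `|f e| * fpsnorm (l * s) d (P e))).
  rewrite /fpsnorm (eq_bigr (fun e : 'X_{1..n < d} =>
     \sum_(m : 'X_{1..k < d}) `|f e| * (`|P e m| * (l * s) ^+ mdeg m))) => [|e _]; last first.
    by rewrite mulr_sumr.
  rewrite exchange_big /=; apply: ler_sum => m _.
  rewrite (eq_bigr (fun e : 'X_{1..n < d} =>
    (`|f e * P e m|) * (l * s) ^+ mdeg m)) => [|e _]; last by rewrite normrM mulrA.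
  rewrite -mulr_suml ler_wpM2r ?exprn_ge0 //.
  apply: le_trans (ler_norm_sum _ _ _) _.
  pose Im : subFinType _ := 'X_{1..n < (mdeg m).+1}.
  pose Id : subFinType _ := 'X_{1..n < d}.
  rewrite (big_sub_widen Im Id xpredT (fun e => `|f e * P e m|)) /=; last first.
    by move=> e /leq_trans; apply; exact: bmdeg.
  by rewrite big_mkcond /=; apply: ler_sum => e _; case: ifP.
apply: le_trans (hf d); apply: ler_sum => e _.
by rewrite ler_wpM2l //; apply: fpsnorm_monom.
Qed.

End ConvergentSubst.

Section FpsOrder.
Variables (K : idomainType) (n : nat).
Implicit Types (f g : fps K n).

Definition has_degree f (d : nat) : bool :=
  [exists m : 'X_{1..n < d.+1}, (mdeg m == d) && (f m != 0)].

(* The smallest degree of a monomial of f, and +oo if f = 0. *)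
Definition fpsord f : \bar int :=
  if pselect (exists d, has_degree f d) is left ex then (ex_minn ex)%:Z%:E
  else +oo%E.

Lemma has_degreeP f d :
  reflect (exists2 m, mdeg m = d & f m != 0) (has_degree f d).
Proof.
apply: (iffP existsP) => [[m /andP [/eqP md fm]]|[m md fm]]; first by exists m.
have lt : (mdeg m < d.+1)%N by rewrite md.
by exists (BMultinom lt) => /=; rewrite md eqxx.
Qed.

Lemma fps_neq0 f : f != 0 -> exists d, has_degree f d.
Proof.
move=> f0; apply: contrapT => h; case/eqP: f0; apply: fpsP => m.
apply: contrapT => /eqP fm; apply: h; exists (mdeg m).
by apply/has_degreeP; exists m.
Qed.

Lemma fpsM_eq0 f g : f * g = 0 -> (f == 0) || (g == 0).
Proof.
have low (h : fps K n) : h != 0 -> exists (d : nat) (p : {mpoly K[n]}),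
    [/\ p != 0, forall m, p@_m = if mdeg m == d then h m else 0
      & forall m, (mdeg m < d)%N -> h m = 0].
  move=> /fps_neq0 ex; case: (ex_minnP ex) => d /has_degreeP [m0 md hm0] dmin.
  have hlow m : (mdeg m < d)%N -> h m = 0.
    move=> lt; apply/eqP; apply: contraTT lt => hm; rewrite -leqNgt.
    by apply: dmin; apply/has_degreeP; exists m.
  have pE m : (ftrunc d.+1 h)@_m = if mdeg m == d then h m else 0.
    case: (ltngtP (mdeg m) d) => [lt|gt|e].
    - by rewrite mcoeff_ftrunc ?hlow // ltnS ltnW.
    - rewrite /ftrunc raddf_sum /= big1 // => k _; rewrite mcoeffZ mcoeffX.
      case: eqP => [e|_]; last by rewrite mulr0.
      by move: (bmdeg k); rewrite e ltnS leqNgt gt.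
    - by rewrite mcoeff_ftrunc // e.
  exists d, (ftrunc d.+1 h); split => //.
  by apply: contra_neq hm0 => p0; move: (pE m0); rewrite p0 mcoeff0 md eqxx.
move=> fg0; apply: contraT; rewrite negb_or => /andP [/low [d [p [p0 pE fl]]]].
move=> /low [e [q [q0 qE gl]]].
have /eqP [] : p * q != 0 by rewrite mulf_neq0.
apply/mpolyP => m; rewrite mcoeff0 mcoeffM.
have [md|md] := eqVneq (mdeg m) (d + e)%N; last first.
  apply: big1 => -[k1 k2] /= /eqP mE; rewrite pE qE.
  case: eqP => [e1|_]; last by rewrite mul0r.
  case: eqP => [e2|_]; last by rewrite mulr0.
  by case/eqP: md; move: (congr1 mdeg mE); rewrite mdegD e1 e2.
rewrite -[RHS](fpscoef0 K m) -fg0 fpscoefM; apply: eq_bigr => -[k1 k2] /= /eqP mE.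
have kd : (mdeg k1 + mdeg k2 = d + e)%N by rewrite -mdegD -mE.
rewrite pE qE; case: (ltngtP (mdeg k1) d) => [lt|gt|e1].
- by rewrite (fl _ lt) !mul0r.
- have lt : (mdeg k2 < e)%N by rewrite -(ltn_add2l d) -kd ltn_add2r.
  by rewrite (gl _ lt) mul0r mulr0.
- by move/eqP: kd; rewrite e1 eqn_add2l => ->.
Qed.

End FpsOrder.

(* For K = C, the local ring of germs of analytic functions of n variables at 0. *)

Record germ (K : numFieldType) (n : nat) :=
  Germ { gser :> fps K n; _ : `[< convergent gser >] }.

HB.instance Definition _ (K : numFieldType) (n : nat) :=
  [isSub for @gser K n].
HB.instance Definition _ (K : numFieldType) (n : nat) :=
  [Choice of germ K n by <:].

Section GermRing.
Variables (K : numFieldType) (n : nat).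

Fact convergent_subring : subring_closed (fun f : fps K n => `[< convergent f >]).
Proof.
split; first exact/asboolP/convergent1.
- by move=> f g /asboolP cf /asboolP cg; apply/asboolP/convergentB.
- by move=> f g /asboolP cf /asboolP cg; apply/asboolP/convergentM.
Qed.

HB.instance Definition _ :=
  GRing.SubChoice_isSubComNzRing.Build (fps K n) _ (germ K n) convergent_subring.

Implicit Types f g : germ K n.

Definition germ_unit : {pred germ K n} := fun f => `[< exists g, g * f = 1 >].

Definition germ_inv f : germ K n :=
  if pselect (exists g, g * f = 1) is left ex then sval (cid ex) else f.

Fact germ_mulVx : {in germ_unit, left_inverse 1 germ_inv *%R}.
Proof.
move=> f /asboolP ex; rewrite /germ_inv; case: pselect => // ex'.
by case: cid.
Qed.

Fact germ_unitPl f g : g * f = 1 -> germ_unit f.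
Proof. by move=> e; apply/asboolP; exists g. Qed.

Fact germ_invr_out : {in [predC germ_unit], germ_inv =1 id}.
Proof.
move=> f nu; rewrite /germ_inv; case: pselect => // ex.
by move: nu; rewrite inE /= => /negP []; apply/asboolP.
Qed.

HB.instance Definition _ := GRing.ComNzRing_hasMulInverse.Build (germ K n)
  germ_mulVx germ_unitPl germ_invr_out.

Fact germ_integral : GRing.integral_domain_axiom (germ K n).
Proof. by move=> f g /(congr1 val) /fpsM_eq0; rewrite -!(inj_eq val_inj). Qed.

HB.instance Definition _ :=
  GRing.ComUnitRing_isIntegral.Build (germ K n) germ_integral.

Definition gconst (c : K) : germ K n := Germ (asboolT (convergentC n c)).
Definition gvar (i : 'I_n) : germ K n := Germ (asboolT (convergentX K i)).
Definition gderiv (i : 'I_n) f : germ K n :=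
  Germ (asboolT (convergent_deriv i (asboolW (valP f)))).

Definition gord f : \bar int := fpsord f.

End GermRing.

Section GermSubst.
Variables (K : numFieldType) (n k : nat).

Fact gsubst_subproof (f : germ K n) (g : n.-tuple (germ K k)) :
  convergent (fpssubst f (map_tuple val g)).
Proof.
apply: convergent_subst; first exact/asboolP/(valP f).
by move=> i; rewrite tnth_map; exact/asboolP/(valP (tnth g i)).
Qed.

Definition gsubst (f : germ K n) (g : n.-tuple (germ K k)) : germ K k :=
  Germ (asboolT (gsubst_subproof f g)).

End GermSubst.

Notation "x %:F" := (@FracField.tofrac _ x) : ring_scope.

Section Meromorphic.
Variable K : numFieldType.
Implicit Types q : {fraction (germ K 1)}.

(* Order of pole or zero at 0; the denominator is nonzero, so that its order is
   finite, and mord 0 = +oo. *)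
Definition mord q : \bar int := (gord \n_(repr q) - gord \d_(repr q))%E.

Definition holomorphic q : Prop := exists u : germ K 1, q = u%:F.

End Meromorphic.

(* The submodule generated by S: the finite linear combinations. *)
Definition gen_submod (A : nzRingType) (V : lmodType A) (S : V -> Prop) (v : V) : Prop :=
  exists (r : nat) (c : 'I_r -> A) (s : 'I_r -> V),
    (forall i, S (s i)) /\ v = \sum_(i < r) c i *: s i.

Section Double.
Variable K : numFieldType.

(* The free module of rank 2 over the local ring of C^n at 0. *)
Definition germ2 (n : nat) : lmodType (germ K n) :=
  ((germ K n)^o * (germ K n)^o)%type.

(* The coordinates x, y of C^2 have the indices 0, 1. *)
Definition df_dx (f : germ K 2) : germ K 2 := gderiv ord0 f.
Definition df_dy (f : germ K 2) : germ K 2 := gderiv ord_max f.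

Definition jacobian_ideal (f : germ K 2) : germ K 2 -> Prop :=
  gen_submod (V := (germ K 2)^o) (fun h => h = df_dx f \/ h = df_dy f).

Definition proj_fst : 2.-tuple (germ K (2 + 2)) :=
  [tuple gvar K (lshift 2 i) | i < 2].
Definition proj_snd : 2.-tuple (germ K (2 + 2)) :=
  [tuple gvar K (rshift 2 i) | i < 2].

Definition germ_double (h : germ K 2) : germ2 (2 + 2) :=
  (gsubst h proj_fst, gsubst h proj_snd).

Definition jacobian_double (f : germ K 2) : germ2 (2 + 2) -> Prop :=
  gen_submod (fun v => exists2 h, jacobian_ideal f h & v = germ_double h).

Definition pullback2 (n k : nat) (Phi : n.-tuple (germ K k)) (v : germ2 n) : germ2 k :=
  (gsubst v.1 Phi, gsubst v.2 Phi).

Definition pullback_submod (n k : nat) (Phi : n.-tuple (germ K k))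
    (M : germ2 n -> Prop) : germ2 k -> Prop :=
  gen_submod (fun w => exists2 v, M v & w = pullback2 Phi v).

End Double.

Section Curves.
Variable K : numFieldType.

(* f vanishes at 0, is not zero, and the quotient of the local ring by (f) has
   no nilpotent element. *)
Definition reduced_curve (f : germ K 2) : Prop :=
  [/\ f != 0, f 0%MM = 0
    & forall (h : germ K 2) (r : nat),
        (exists q, h ^+ r = q * f) -> exists q, h = q * f].

Definition polar (f : germ K 2) (a : K) : germ K 2 :=
  df_dx f - gconst 2 a * df_dy f.

(* t |-> (x(t), t^N) *)
Definition branch (N : nat) (x : germ K 1) : 2.-tuple (germ K 1) :=
  [tuple x; gvar K ord0 ^+ N].

Definition is_branch (h : germ K 2) (N : nat) (x : germ K 1) : Prop :=
  [/\ (0 < N)%N, x 0%MM = 0 & gsubst h (branch N x) = 0].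

Definition contact (x1 x2 : germ K 1) : \bar int := gord (x1 - x2).

End Curves.

(* Main.v *)
Require Import Defs.
From HB Require Import structures.
From mathcomp Require Import all_boot all_order all_algebra fraction ssrcomplements mpoly.
From mathcomp Require Import cyclic separable cyclotomic.
From mathcomp Require Import boolp reals constructive_ereal complex.

Set Implicit Arguments.
Unset Strict Implicit.
Unset Printing Implicit Defensive.

Import Order.TTheory GRing.Theory Num.Theory.
Local Open Scope ring_scope.

(** Write u1, u2 for f_y along the two branches. The polar equation says that
    f_x = a f_y along each of them, so an element of J(f) pulls back to
    (k(phi1) u1, k(phi2) u2) for some k in O_2: if u1 and u2 are nonzero,
    dividing by them turns the pulled-back submodule into the O_1-module M
    generated by the pairs (k(phi1), k(phi2)). As phi1 and phi2 have the same
    second coordinate, k(phi1) - k(phi2) is a multiple of x1 - x2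
    ([gsubst_branch_dvd]); conversely k = 1 and k = x give (1, 1) and (x1, x2),
    hence (x1 - x2, 0), so that M consists of all pairs whose difference is a
    multiple of x1 - x2 ([pullback_balanced], [balanced_pullback]). Since O_1 is
    a discrete valuation ring ([gord_le_dvd]), this is the condition that the
    order of the difference is at least the contact.

    Reducedness enters through u1 <> 0 and u2 <> 0
    ([reduced_curve_smooth_arc]). If f_y vanished along a branch (x(t), t^N),
    so would f_x, and then f by the chain rule ([gderiv_subst]). Put
    F(X, Y) = f(X, Y^N) and let z be a primitive N-th root of unity. Every
    conjugate r = x(z^j t) satisfies F(r(Y), Y) = 0 and F_X(r(Y), Y) = 0, so F is
    divisible by the square of the product of the X - r over the distinct
    conjugates ([double_roots_dvd]). This product and its cofactor are invariant
    under Y -> z Y, hence are series in X and Y^N ([rotate2_fixed]), and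
    f = p^2 q in O_2 with p(0) = 0 ([double_branch]). Then (p q)^2 is a multiple
    of f, but p q is not.

    All the germs constructed on the way have to converge. Substitution preserves
    convergence, so inverses come from the geometric series ([germ_unitP]) and
    division by X - r(Y) from a translation followed by division by a variable
    ([root_dvd]). The algebraic properties of substitution are inherited from
    polynomial evaluation, because a coefficient of degree < d of any expression
    depends only on truncations at degree d ([fpssubst_poly]). *)

(** * Formal power series: derivation and substitution *)

Section FpsCoef.
Variables (K : comNzRingType) (n : nat).
Implicit Types (f g : fps K n) (m : 'X_{1..n}).

Lemma fpscoef_sum (I : Type) (r : seq I) (P : pred I) (F : I -> fps K n) m :
  (\sum_(i <- r | P i) F i) m = \sum_(i <- r | P i) F i m.
Proof. by elim/big_rec2: _ => // i _ f _ <-. Qed.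

Lemma eq_fpscoefM f f' g g' m :
    (forall k, (mdeg k <= mdeg m)%N -> f k = f' k) ->
    (forall k, (mdeg k <= mdeg m)%N -> g k = g' k) ->
  (f * g) m = (f' * g') m.
Proof.
move=> hf hg; rewrite !fpscoefM; apply: eq_bigr => k _.
by rewrite hf ?hg // -ltnS bmdeg.
Qed.

Lemma fpscoefM_poly f g (p q : {mpoly K[n]}) m :
    (forall k, (mdeg k <= mdeg m)%N -> p@_k = f k) ->
    (forall k, (mdeg k <= mdeg m)%N -> q@_k = g k) ->
  (f * g) m = (p * q)@_m.
Proof.
move=> hp hq; rewrite fpscoefM mcoeffM; apply: eq_bigr => k _.
by rewrite hp ?hq // -ltnS bmdeg.
Qed.

Lemma fpscoefCM (c : K) f m : (fpsC n c * f) m = c * f m.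
Proof.
rewrite (@fpscoefM_poly _ _ c%:MP (ftrunc (mdeg m).+1 f)) => [|k le|k le].
- by rewrite mul_mpolyC mcoeffZ mcoeff_ftrunc.
- by rewrite mcoeffC eq_sym mulr_natr eq_sym.
- by rewrite mcoeff_ftrunc.
Qed.

Fact fpsC_zmod_morphism : zmod_morphism (@fpsC K n).
Proof.
move=> a b; apply: fpsP => m /=; rewrite /fpsC /= -[RHS]/(a *+ _ + - (b *+ _)).
by rewrite mulrnBl.
Qed.

HB.instance Definition _ :=
  GRing.isZmodMorphism.Build K (fps K n) (@fpsC K n) fpsC_zmod_morphism.

Fact fpsC_monoid_morphism : monoid_morphism (@fpsC K n).
Proof.
split; first by apply: fpsP.
by move=> a b; apply: fpsP => m; rewrite fpscoefCM /= mulrnAr.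
Qed.

HB.instance Definition _ :=
  GRing.isMonoidMorphism.Build K (fps K n) (@fpsC K n) fpsC_monoid_morphism.

Definition vanish_below d f := forall m, (mdeg m < d)%N -> f m = 0.

Lemma vanish_belowM d e f g :
  vanish_below d f -> vanish_below e g -> vanish_below (d + e) (f * g).
Proof.
move=> hf hg m lt; rewrite fpscoefM big1 // => -[k1 k2] /= /eqP mE.
case: (ltnP (mdeg k1) d) => [/hf -> | dk]; first by rewrite mul0r.
rewrite hg ?mulr0 // -(ltn_add2l d); apply: leq_ltn_trans lt.
by apply: (@leq_trans (mdeg k1 + mdeg k2)%N); rewrite ?leq_add2r // -mdegD -mE.
Qed.

Lemma fpsderivE (i : 'I_n) f m : fpsderiv i f m = f (m + U_(i))%MM *+ (m i).+1.
Proof. by []. Qed.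

Lemma fpsderivD (i : 'I_n) f g :
  fpsderiv i (f + g) = fpsderiv i f + fpsderiv i g.
Proof. by apply: fpsP => m; rewrite /= mulrnDl. Qed.

Lemma fpsderiv_poly (i : 'I_n) f (p : {mpoly K[n]}) d :
    (forall k, (mdeg k < d.+1)%N -> p@_k = f k) ->
  forall k, (mdeg k < d)%N -> (mderiv i p)@_k = fpsderiv i f k.
Proof.
by move=> hp k lt; rewrite mcoeff_deriv hp ?mdegD ?mdeg1 ?addn1.
Qed.

Lemma fpsderivM (i : 'I_n) f g :
  fpsderiv i (f * g) = fpsderiv i f * g + f * fpsderiv i g.
Proof.
apply: fpsP => m.
(* A derivative in degree |m| reads coefficients in degree |m| + 1. *)
pose d := (mdeg m).+2.
have tr (h : fps K n) k : (mdeg k < d)%N -> (ftrunc d h)@_k = h k by apply: mcoeff_ftrunc.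
have trd (h : fps K n) k : (mdeg k < d.-1)%N -> (mderiv i (ftrunc d h))@_k = fpsderiv i h k.
  by apply: fpsderiv_poly => e; apply: tr.
rewrite -(@fpsderiv_poly _ _ (ftrunc d f * ftrunc d g) d.-1) //; last first.
  move=> k lt; rewrite (@fpscoefM_poly _ _ (ftrunc d f) (ftrunc d g)) // => j le;
  by rewrite tr // (leq_ltn_trans le).
rewrite mderivM mcoeffD; congr (_ + _).
  by rewrite (@fpscoefM_poly _ _ (mderiv i (ftrunc d f)) (ftrunc d g)) // => k le;
    rewrite (trd, tr) // (leq_ltn_trans le).
by rewrite (@fpscoefM_poly _ _ (ftrunc d f) (mderiv i (ftrunc d g))) // => k le;
  rewrite (trd, tr) // (leq_ltn_trans le).
Qed.

Lemma fpsderivC (i : 'I_n) (c : K) : fpsderiv i (fpsC n c) = 0.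
Proof.
by apply: fpsP => m /=; rewrite -mdeg_eq0 mdegD mdeg1 addn1 mul0rn.
Qed.

Lemma fpsderivX (i j : 'I_n) : fpsderiv i (fpsX K j) = (i == j)%:R.
Proof.
apply: fpsP => m /=; have [->|ne] := eqVneq i j.
  rewrite -[X in _ == X]add0m eqm_add2r fpscoef1.
  by have [->|_] := eqVneq m 0%MM; rewrite ?mnm0E ?mul0rn.
rewrite (_ : _ == _ = false) ?mul0rn //; apply/negbTE/eqP => /mnmP /(_ i).
by rewrite mnmDE !mnm1E eqxx eq_sym (negbTE ne) addn1.
Qed.

Lemma fpscoef0M f g : (f * g) 0%MM = f 0%MM * g 0%MM.
Proof.
rewrite (@fpscoefM_poly _ _ (ftrunc 1 f) (ftrunc 1 g)) => [|k|k]; last 2 first.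
- by rewrite mdeg0 => le; rewrite mcoeff_ftrunc.
- by rewrite mdeg0 => le; rewrite mcoeff_ftrunc.
by rewrite rmorphM /= !mcoeff_ftrunc ?mdeg0.
Qed.

End FpsCoef.

Section FpsSubstPoly.
Variables (K : comNzRingType) (n k : nat) (g : n.-tuple (fps K k)).
Hypothesis g0 : forall i, tnth g i 0%MM = 0.
Local Notation ev := (mmap (@fpsC K k) (tnth g)).

Lemma vanish_below_mmap1 (e : 'X_{1..n}) :
  vanish_below (mdeg e) (mmap1 (tnth g) e).
Proof.
rewrite mdegE /mmap1; elim/big_rec2: _ => [m //|i d h _ IH].
apply: vanish_belowM IH; elim: (e i) => [m //|c IHc].
rewrite exprS -[c.+1]add1n; apply: vanish_belowM IHc => m.
by rewrite ltnS leqn0 mdeg_eq0 => /eqP ->.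
Qed.

(** In degree < d only the monomials of degree < d of f contribute, because those
    of the tuple have no constant term: any polynomial agreeing with f there can
    replace f. *)
Lemma fpssubst_poly (f : fps K n) (p : {mpoly K[n]}) d m :
    (forall e, (mdeg e < d)%N -> p@_e = f e) -> (mdeg m < d)%N ->
  fpssubst f g m = ev p m.
Proof.
move=> hp lt; rewrite /fpssubst ifT; last by apply/forallP => i; rewrite g0.
rewrite (mmapE _ (leq_maxl (msize p) d)) fpscoef_sum.
pose D := maxn (msize p) d.
rewrite [RHS](eq_bigr (fun e : 'X_{1..n < D} => p@_e * (mmap1 (tnth g) e) m)) /=;
  last by move=> e _; apply: fpscoefCM.
pose Im : subFinType _ := 'X_{1..n < (mdeg m).+1}.
pose ID : subFinType _ := 'X_{1..n < D}.
rewrite (big_sub_widen Im ID xpredT (fun e => f e * (mmap1 (tnth g) e) m)) /=; last first.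
  by move=> e /leq_trans; apply; rewrite leq_max lt orbT.
rewrite big_mkcond /=; apply: eq_bigr => e _.
rewrite ltnS; case: leqP => le; first by rewrite hp ?(leq_ltn_trans le).
by rewrite vanish_below_mmap1 ?mulr0.
Qed.

Lemma fpssubst_trunc (f : fps K n) d m : (mdeg m < d)%N ->
  fpssubst f g m = ev (ftrunc d f) m.
Proof. by apply: fpssubst_poly => e; apply: mcoeff_ftrunc. Qed.

Fact fpssubst_zmod_morphism : zmod_morphism (fun f : fps K n => fpssubst f g).
Proof.
move=> f h; apply: fpsP => m; pose d := (mdeg m).+1.
rewrite (@fpssubst_poly _ (ftrunc d f - ftrunc d h) d) //; last first.
  by move=> e lt; rewrite mcoeffB !mcoeff_ftrunc.
by rewrite mmapB fpscoefD fpscoefN -!fpssubst_trunc.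
Qed.

Fact fpssubst_monoid_morphism : monoid_morphism (fun f : fps K n => fpssubst f g).
Proof.
split=> [|f h]; apply: fpsP => m; pose d := (mdeg m).+1.
  rewrite (@fpssubst_poly _ 1 d) //; last by move=> e lt; rewrite mcoeff1.
  by rewrite -mpolyC1 mmapC.
rewrite (@fpssubst_poly _ (ftrunc d f * ftrunc d h) d) //; last first.
  by move=> e lt; rewrite (@fpscoefM_poly _ _ _ _ (ftrunc d f) (ftrunc d h)) // => j le;
    rewrite mcoeff_ftrunc // (leq_ltn_trans le).
rewrite rmorphM /=; apply: eq_fpscoefM => j le; exact/esym/fpssubst_trunc.
Qed.

Lemma fpssubstC (c : K) : fpssubst (fpsC n c) g = fpsC k c.
Proof.
apply: fpsP => m; rewrite (@fpssubst_poly _ c%:MP (mdeg m).+1) //.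
  by rewrite mmapC.
by move=> e lt; rewrite mcoeffC eq_sym mulr_natr eq_sym.
Qed.

Lemma fpssubstX i : fpssubst (fpsX K i) g = tnth g i.
Proof.
apply: fpsP => m; rewrite (@fpssubst_poly _ 'X_i (mdeg m).+1) //.
  by rewrite mmapX mmap1U.
by move=> e lt; rewrite mcoeffX eq_sym.
Qed.

Lemma fpssubst_coef0 (f : fps K n) : fpssubst f g 0%MM = f 0%MM.
Proof.
rewrite (@fpssubst_poly _ (f 0%MM)%:MP 1) ?mdeg0 // => [|e].
  by rewrite mmapC /= eqxx.
by rewrite ltnS leqn0 mdeg_eq0 => /eqP ->; rewrite mcoeffC eqxx mulr1.
Qed.

(** Both sides are derivations in p along the evaluation, so constants and
    variables suffice. *)
Lemma chain_rule_poly (j : 'I_k) (p : {mpoly K[n]}) :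
  fpsderiv j (ev p) = \sum_i ev (mderiv i p) * fpsderiv j (tnth g i).
Proof.
pose P q := fpsderiv j (ev q) = \sum_i ev (mderiv i q) * fpsderiv j (tnth g i).
have PM q r : P q -> P r -> P (q * r).
  rewrite /P rmorphM /= fpsderivM => -> ->.
  rewrite mulr_suml mulr_sumr -big_split; apply: eq_bigr => i _ /=.
  by rewrite mderivM mmapD !rmorphM /= mulrDl mulrAC mulrA.
have PD q r : P q -> P r -> P (q + r).
  rewrite /P mmapD fpsderivD => -> ->.
  by rewrite -big_split; apply: eq_bigr => i _ /=; rewrite mderivD mmapD mulrDl.
have PC c : P c%:MP.
  rewrite /P mmapC fpsderivC big1 // => i _.
  by rewrite mderivC mmap0 mul0r.
have PX i : P 'X_i.
  rewrite /P mmapX mmap1U (bigD1 i) //= big1 ?addr0 => [|i' ne]; rewrite mderivX mnm1E.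
    by rewrite eqxx scale1r -[X in (X - _)%MM]add0m addmK mpolyX0 rmorph1 mul1r.
  by rewrite eq_sym (negbTE ne) scale0r mmap0 mul0r.
change (P p); elim/mpolyind: p => [|c m p _ _ IHp]; first by rewrite -mpolyC0.
apply: PD => //; rewrite -mul_mpolyC; apply: (PM) => //.
rewrite mpolyXE_id; apply: (big_ind P) => [|q r|]; [by rewrite -mpolyC1|exact: (PM)|].
move=> i _; elim: (m i) => [|e IHe]; first by rewrite expr0 -mpolyC1.
by rewrite exprS; apply: (PM).
Qed.

Lemma fpsderiv_subst (j : 'I_k) (f : fps K n) :
  fpsderiv j (fpssubst f g)
    = \sum_i fpssubst (fpsderiv i f) g * fpsderiv j (tnth g i).
Proof.
apply: fpsP => m; pose d := (mdeg m).+2.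
have ltd : (mdeg (m + U_(j)) < d)%N by rewrite mdegD mdeg1 addn1.
rewrite fpsderivE (fpssubst_trunc _ ltd) -fpsderivE chain_rule_poly !fpscoef_sum.
apply: eq_bigr => i _; apply: eq_fpscoefM => // e le.
rewrite (@fpssubst_poly _ (mderiv i (ftrunc d f)) d.-1) //.
by apply: fpsderiv_poly => e'; apply: mcoeff_ftrunc.
Qed.

End FpsSubstPoly.

Lemma fpssubst_comp (K : comNzRingType) (n k l : nat) (f : fps K n)
    (g : n.-tuple (fps K k)) (h : k.-tuple (fps K l)) :
    (forall i, tnth g i 0%MM = 0) -> (forall i, tnth h i 0%MM = 0) ->
  fpssubst (fpssubst f g) h = fpssubst f (map_tuple (fun f : fps K k => fpssubst f h) g).
Proof.
move=> g0 h0; pose gh := map_tuple (fun f : fps K k => fpssubst f h) g.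
have gh0 i : tnth gh i 0%MM = 0 by rewrite tnth_map fpssubst_coef0.
pose F : {rmorphism fps K k -> fps K l} :=
  HB.pack (fun f : fps K k => fpssubst f h)
   (GRing.isZmodMorphism.Build _ _ _ (fpssubst_zmod_morphism h0))
   (GRing.isMonoidMorphism.Build _ _ _ (fpssubst_monoid_morphism h0)).
have Fev p : F (mmap (@fpsC K k) (tnth g) p) = mmap (@fpsC K l) (tnth gh) p.
  rewrite !(mmapE _ (leqnn (msize p))) rmorph_sum; apply: eq_bigr => e _ /=.
  rewrite -[LHS]/(F _) rmorphM; congr (_ * _); first exact: fpssubstC.
  rewrite rmorph_prod; apply: eq_bigr => i _.
  by rewrite rmorphXn /= tnth_map.
apply: fpsP => m; pose d := (mdeg m).+1.
rewrite (fpssubst_trunc gh0 _ (ltnSn _)) -Fev /= !(fpssubst_trunc h0 _ (ltnSn _)).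
congr (fpscoef (mmap _ _ _) m); apply/mpolyP => e.
case: (ltnP (mdeg e) d) => lt; first by rewrite !mcoeff_ftrunc // (fpssubst_trunc g0 _ lt).
rewrite /ftrunc !raddf_sum /=; apply: eq_bigr => e' _; rewrite !mcoeffZ mcoeffX.
case: eqP => [ee|]; last by rewrite !mulr0.
by move: (bmdeg e'); rewrite ee ltnNge lt.
Qed.

(** * Monomial substitutions *)

Section Monomials.
Variables (K : comNzRingType) (n : nat).

Definition fpsmonom (e : 'X_{1..n}) : fps K n := Fps (fun m => (m == e)%:R).

Lemma fpscoef_monomM e (f : fps K n) m : (fpsmonom e * f) (m + e)%MM = f m.
Proof.
pose d := (mdeg (m + e)).+1.
rewrite (@fpscoefM_poly _ _ _ _ 'X_[e] (ftrunc d f)) => [|k le|k le].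
- by rewrite mulrC addmC mcoeffMX mcoeff_ftrunc // ltnS mdegD leq_addr.
- by rewrite mcoeffX eq_sym.
- by rewrite mcoeff_ftrunc.
Qed.

Lemma fpsmonomD e e' : fpsmonom (e + e')%MM = fpsmonom e * fpsmonom e'.
Proof.
apply: fpsP => m; rewrite (@fpscoefM_poly _ _ _ _ 'X_[e] 'X_[e']) => [|k le|k le].
- by rewrite -mpolyXD mcoeffX eq_sym.
- by rewrite mcoeffX eq_sym.
- by rewrite mcoeffX eq_sym.
Qed.

Lemma fpsmonom_sum (I : Type) (r : seq I) (P : pred I) (e : I -> 'X_{1..n}) :
  \prod_(i <- r | P i) fpsmonom (e i) = fpsmonom (\sum_(i <- r | P i) e i)%MM.
Proof.
apply/esym; apply: (big_morph fpsmonom fpsmonomD).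
exact: fpsP.
Qed.

Lemma fpsmonomMn e k : fpsmonom e ^+ k = fpsmonom (e *+ k)%MM.
Proof.
elim: k => [|k IHk]; first by rewrite mulm0n; apply: fpsP.
by rewrite exprS IHk mulmS fpsmonomD.
Qed.

Lemma fpscoef_XM (i : 'I_n) (f : fps K n) m :
  (fpsX K i * f) m = if m i is 0%N then 0 else f (m - U_(i))%MM.
Proof.
case mi: (m i) => [|c]; last first.
  have le : (U_(i) <= m)%MM by rewrite lep1mP mi.
  by rewrite -[in LHS](submK le); apply: fpscoef_monomM.
rewrite fpscoefM big1 // => -[k1 k2] /= /eqP mE.
case: eqP => [e1|]; last by rewrite mul0r.
by move/mnmP: mE => /(_ i); rewrite mi mnmDE e1 mnm1E eqxx.
Qed.

(** Substituting monomials in separate variables only rescales and relabels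
    the coefficients; ramification, rotation and restriction to an axis are
    all of this form. *)
Lemma fpscoef_subst_diag (c : 'I_n -> K) (k : 'I_n -> nat)
    (g : n.-tuple (fps K n)) (f : fps K n) m :
    (forall i, (0 < k i)%N) ->
    (forall i, tnth g i = fpsC n (c i) * fpsX K i ^+ k i) ->
  fpssubst f g m =
    if [forall i, k i %| m i]%N then
      f [multinom (m i %/ k i)%N | i < n] * \prod_(i < n) c i ^+ (m i %/ k i)
    else 0.
Proof.
move=> k0 gE; have g0 i : tnth g i 0%MM = 0.
  by rewrite gE fpscoefCM -(prednK (k0 i)) exprS fpscoef_XM mnm0E mulr0.
have mon e : (\prod_(i < n) tnth g i ^+ e i) m =
    (\prod_(i < n) c i ^+ e i) * (m == [multinom (k i * e i)%N | i < n])%:R.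
  have -> : \prod_(i < n) tnth g i ^+ e i =
      fpsC n (\prod_(i < n) c i ^+ e i) * fpsmonom [multinom (k i * e i)%N | i < n].
    transitivity (\prod_(i < n) (fpsC n (c i ^+ e i) * fpsmonom (U_(i) *+ (k i * e i))%MM)).
      apply: eq_bigr => i _; rewrite gE exprMn -rmorphXn -exprM; congr (_ * _).
      exact: fpsmonomMn.
    rewrite big_split /= -rmorph_prod fpsmonom_sum; congr (_ * fpsmonom _).
    apply/mnmP => i; rewrite mnm_sumE mnmE (bigD1 i) //=.
    rewrite mulmnE mnm1E eqxx mul1n big1 ?addn0 // => j ne.
    by rewrite mulmnE mnm1E (negbTE ne).
  exact: fpscoefCM.
rewrite /fpssubst ifT; last by apply/forallP => i; rewrite g0.
rewrite /= (eq_bigr (fun e : 'X_{1..n < (mdeg m).+1} => f e *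
  ((\prod_(i < n) c i ^+ e i) * (m == [multinom (k i * e i)%N | i < n])%:R))); last first.
  by move=> e _; rewrite mon.
case: forallP => [dv|ndv]; last first.
  apply: big1 => e _; case: eqP => [mE|]; last by rewrite !mulr0.
  by case: ndv => i; rewrite ((mnmP _ _).1 mE i) mnmE dvdn_mulr.
have lt : (mdeg [multinom (m i %/ k i)%N | i < n] < (mdeg m).+1)%N.
  by rewrite ltnS !mdegE; apply: leq_sum => i _; rewrite mnmE leq_div.
rewrite (bigD1 (BMultinom lt)) //= [X in _ + X]big1 ?addr0 => [|e ne].
  rewrite (introT eqP _ : m == _) ?mulr1; last first.
    by apply/mnmP => i; rewrite !mnmE mulnC divnK.
  by congr (_ * _); apply: eq_bigr => i _; rewrite mnmE.
case: eqP => [mE|]; last by rewrite !mulr0.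
case/eqP: ne; apply/eqP; rewrite bmeqP; apply/eqP/mnmP => i.
by rewrite mnmE ((mnmP _ _).1 mE i) mnmE mulKn.
Qed.

End Monomials.

(** * Convergence *)

Section Convergence.
Variables (K : numFieldType) (n : nat).

Lemma convergent_le (f g : fps K n) :
  (forall m, `|f m| <= `|g m|) -> convergent g -> convergent f.
Proof.
move=> le [s [M [s0 h]]]; exists s, M; split=> // d; apply: le_trans (h d).
by apply: ler_sum => m _; rewrite ler_wpM2r ?exprn_ge0 // ltW.
Qed.

(** The coefficients are dominated by those of the derivative. *)
Lemma convergent_shift (i : 'I_n) (f : fps K n) :
  convergent f -> convergent (Fps (fun m => f (m + U_(i))%MM)).
Proof.
move/(convergent_deriv i); apply: convergent_le => m /=.
by rewrite normrMn -mulr_natr ler_peMr // ler1n.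
Qed.

(** On a polydisc of polyradius s <= 1, the monomial of exponents k_i * m_i is
    at least s ^ (b * |m|) with b the sum of the k_i, so that the contracted
    series converges at polyradius s ^ b. *)
Lemma convergent_contract (k : 'I_n -> nat) (f : fps K n) :
    (forall i, (0 < k i)%N) -> convergent f ->
  convergent (Fps (fun m => f [multinom (k i * m i)%N | i < n])).
Proof.
move=> k0 [s' [M [s'0 h']]].
(* This s is below both 1 and s'. *)
pose s := s' / (s' + 1).
have s1p : 0 < s' + 1 by rewrite addr_gt0.
have s0 : 0 < s by rewrite divr_gt0.
have s1 : s <= 1 by rewrite ler_pdivrMr // mul1r lerDl.
have ss' : s <= s' by rewrite ler_pdivrMr // ler_peMr ?lerDr // ltW.
have h d : fpsnorm s d f <= M.
  by apply: le_trans (h' d); apply: fpsnorm_mono => //; apply: ltW.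
pose b := (\sum_i k i)%N; pose km (m : 'X_{1..n}) := [multinom (k i * m i)%N | i < n].
have mdeg_km m : (mdeg (km m) <= b * mdeg m)%N.
  rewrite !mdegE big_distrr /=; apply: leq_sum => i _; rewrite mnmE leq_mul2r.
  by rewrite /b (bigD1 i) //= leq_addr orbT.
have km_inj m m' : km m = km m' -> m = m'.
  move=> /mnmP e; apply/mnmP => i; move: (e i); rewrite !mnmE => /eqP.
  by rewrite eqn_pmul2l // => /eqP.
exists (s ^+ b), M; split; first exact: exprn_gt0.
move=> d; pose D := (b * d).+1; apply: le_trans (h D).
pose G (m : 'X_{1..n}) : K := `|f m| * s ^+ mdeg m.
have G0 m : 0 <= G m by apply: mulr_ge0 => //; apply/exprn_ge0/ltW.
apply: (@le_trans _ _ (\sum_(m : 'X_{1..n < d})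
    \sum_(m' : 'X_{1..n < D} | (m' : 'X_{1..n}) == km m) G m')).
  apply: ler_sum => m _.
  have lt : (mdeg (km m) < D)%N.
    by rewrite ltnS (leq_trans (mdeg_km _)) // leq_mul2l (ltnW (bmdeg m)) orbT.
  rewrite (big_pred1 (BMultinom lt)) => [|m' /=]; last by rewrite bmeqP.
  rewrite /G /= ler_wpM2l // -exprM; apply: ler_wiXn2l => //; exact: ltW.
rewrite (exchange_big_dep xpredT) //=; apply: ler_sum => m' _.
have [[m0 e0]|no] := pselect (exists m0, (m' : 'X_{1..n}) = km m0).
  apply: le_trans (@sum_bmonom_le _ _ d m0 (G m') (G0 m')).
  rewrite big_mkcond [X in _ <= X]big_mkcond /=; apply: ler_sum => m _.
  case: eqP => [e|_]; last by case: ifP => _; rewrite ?G0.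
  by rewrite ifT //; apply/eqP/km_inj; rewrite -e0 -e.
by rewrite big_pred0 ?G0 // => m; apply/negbTE/eqP => e; apply: no; exists m.
Qed.

Lemma fpsnormX_le (i : 'I_n) (s : K) d : 0 <= s -> fpsnorm s d (fpsX K i) <= s.
Proof.
move=> s0; apply: le_trans (@sum_bmonom_le K n d U_(i)%MM s s0).
rewrite [X in _ <= X]big_mkcond /=; apply: ler_sum => m _ /=.
case: eqP => [->|_]; last by rewrite normr0 mul0r.
by rewrite normr1 mul1r mdeg1.
Qed.

End Convergence.

Definition fpsgeom (K : numFieldType) : fps K 1 := Fps (fun=> 1).

Lemma fpsgeomE (K : numFieldType) : fpsgeom K = 1 + fpsX K ord0 * fpsgeom K.
Proof.
apply: fpsP => m; rewrite fpscoefD fpscoef_XM fpscoef1 /=.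
case mi: (m ord0) => [|c].
  rewrite (_ : m = 0%MM) ?eqxx ?addr0 //.
  by apply/mnmP => i; rewrite ord1 mi mnm0E.
by case: eqP => [m0|_]; [move: mi; rewrite m0 mnm0E | rewrite add0r].
Qed.

(** The geometric series satisfies G = 1 + X G, so its truncated norm at
    polyradius s = 1/2 is at most 1 + s times itself. *)
Lemma convergent_geom (K : numFieldType) : convergent (fpsgeom K).
Proof.
exists 2^-1, 2; split=> [|d]; first by rewrite invr_gt0.
have h0 : 0 <= 2^-1 :> K by rewrite invr_ge0.
have : fpsnorm 2^-1 d (fpsgeom K) <= 1 + 2^-1 * fpsnorm 2^-1 d (fpsgeom K).
  rewrite {1}fpsgeomE; apply: le_trans (fpsnormD _ _ _ h0) _.
  apply: lerD; first exact: fpsnorm1.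
  apply: le_trans (fpsnormM _ _ _ h0) _.
  by apply: ler_wpM2r; [exact: fpsnorm_ge0 | exact: fpsnormX_le].
set x := fpsnorm _ _ _ => le.
have := ler_wpM2l (ler0n K 2) le; rewrite mulrDr mulr1 mulVKf ?pnatr_eq0 //.
by rewrite mulr_natl mulr2n lerD2r.
Qed.

(** * Rings of germs *)

Section GermSubst.
Variables (K : numFieldType) (n k : nat) (g : n.-tuple (germ K k)).
Hypothesis g0 : forall i, tnth g i 0%MM = 0.

Let vg0 i : tnth (map_tuple val g) i 0%MM = 0.
Proof. by rewrite tnth_map; apply: g0. Qed.

Fact gsubst_zmod_morphism : zmod_morphism (fun f : germ K n => gsubst f g).
Proof. by move=> f h; apply: val_inj; apply: (fpssubst_zmod_morphism vg0). Qed.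

Fact gsubst_monoid_morphism : monoid_morphism (fun f : germ K n => gsubst f g).
Proof.
split=> [|f h]; apply: val_inj; first exact: (fpssubst_monoid_morphism vg0).1.
exact: (fpssubst_monoid_morphism vg0).2.
Qed.

Definition gsubst_rmorphism : {rmorphism germ K n -> germ K k} :=
  HB.pack (fun f : germ K n => gsubst f g)
    (GRing.isZmodMorphism.Build _ _ _ gsubst_zmod_morphism)
    (GRing.isMonoidMorphism.Build _ _ _ gsubst_monoid_morphism).

Lemma gsubstB f h : gsubst (f - h) g = gsubst f g - gsubst h g.
Proof. exact: (rmorphB gsubst_rmorphism). Qed.

Lemma gsubstD f h : gsubst (f + h) g = gsubst f g + gsubst h g.
Proof. exact: (rmorphD gsubst_rmorphism). Qed.

Lemma gsubstM f h : gsubst (f * h) g = gsubst f g * gsubst h g.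
Proof. exact: (rmorphM gsubst_rmorphism). Qed.

Lemma gsubst1 : gsubst 1 g = 1.
Proof. exact: (rmorph1 gsubst_rmorphism). Qed.

Lemma gsubst0 : gsubst 0 g = 0.
Proof. exact: (rmorph0 gsubst_rmorphism). Qed.

Lemma gsubstXn f e : gsubst (f ^+ e) g = gsubst f g ^+ e.
Proof. exact: (rmorphXn gsubst_rmorphism). Qed.

Lemma gsubst_prod (I : Type) (r : seq I) (P : pred I) F :
  gsubst (\prod_(i <- r | P i) F i) g = \prod_(i <- r | P i) gsubst (F i) g.
Proof. exact: (rmorph_prod gsubst_rmorphism). Qed.

Lemma gsubst_const c : gsubst (gconst n c) g = gconst k c.
Proof. by apply: val_inj; apply: (fpssubstC vg0). Qed.

Lemma gsubst_var i : gsubst (gvar K i) g = tnth g i.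
Proof.
by apply: val_inj; rewrite -[LHS]/(fpssubst _ _) (fpssubstX vg0) tnth_map.
Qed.

Lemma gsubst_coef0 (f : germ K n) : gsubst f g 0%MM = f 0%MM.
Proof. exact: (fpssubst_coef0 vg0). Qed.

Lemma gderiv_subst (j : 'I_k) (f : germ K n) :
  gderiv j (gsubst f g) = \sum_i gsubst (gderiv i f) g * gderiv j (tnth g i).
Proof.
apply: val_inj; rewrite rmorph_sum -[LHS]/(fpsderiv j (fpssubst _ _)).
rewrite (fpsderiv_subst vg0); apply: eq_bigr => i _.
by rewrite tnth_map.
Qed.

End GermSubst.

Lemma gsubst_comp (K : numFieldType) (n k l : nat) (f : germ K n)
    (g : n.-tuple (germ K k)) (h : k.-tuple (germ K l)) :
    (forall i, tnth g i 0%MM = 0) -> (forall i, tnth h i 0%MM = 0) ->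
  gsubst (gsubst f g) h = gsubst f (map_tuple (fun u => gsubst u h) g).
Proof.
move=> g0 h0; apply: val_inj; rewrite -[LHS]/(fpssubst (fpssubst _ _) _).
rewrite fpssubst_comp => [|i|i]; last 2 first.
- by rewrite tnth_map; apply: g0.
- by rewrite tnth_map; apply: h0.
by congr fpssubst; apply: eq_from_tnth => i; rewrite !tnth_map.
Qed.

Section GermTheory.
Variables (K : numFieldType) (n : nat).
Implicit Types (f g u v : germ K n).

Lemma gderivM i f g : gderiv i (f * g) = gderiv i f * g + f * gderiv i g.
Proof. by apply: val_inj; apply: fpsderivM. Qed.

Lemma gderiv_var (i j : 'I_n) : gderiv i (gvar K j) = (i == j)%:R.
Proof.
by apply: val_inj; rewrite -[LHS]/(fpsderiv i (fpsX K j)) fpsderivX rmorph_nat.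
Qed.

Lemma gderivB i f g : gderiv i (f - g) = gderiv i f - gderiv i g.
Proof.
by apply: val_inj; apply: fpsP => m; apply: mulrnBl.
Qed.

Lemma gcoefD f g m : (f + g) m = f m + g m. Proof. by []. Qed.
Lemma gcoefB f g m : (f - g) m = f m - g m. Proof. by []. Qed.
Lemma gcoef0 m : (0 : germ K n) m = 0. Proof. by []. Qed.

Lemma gcoef0M f g : (f * g) 0%MM = f 0%MM * g 0%MM.
Proof. exact: fpscoef0M. Qed.

Lemma gcoef0Xn f e : (f ^+ e) 0%MM = f 0%MM ^+ e.
Proof.
elim: e => [|e IHe]; last by rewrite !exprS gcoef0M IHe.
by rewrite !expr0 -[LHS]/((0%MM == 0%MM :> 'X_{1..n})%:R) eqxx.
Qed.

Lemma gvar_coef0 (i : 'I_n) : gvar K i 0%MM = 0.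
Proof.
rewrite -[LHS]/((0%MM == U_(i)%MM :> 'X_{1..n})%:R).
by case: eqP => // /(congr1 mdeg); rewrite mdeg0 mdeg1.
Qed.

Lemma gcoef_varM (i : 'I_n) f m :
  (gvar K i * f) m = if m i is 0%N then 0 else f (m - U_(i))%MM.
Proof. exact: fpscoef_XM. Qed.

Lemma gvar_dvd (i : 'I_n) f :
  (forall m : 'X_{1..n}, m i = 0%N -> f m = 0) -> exists h, f = gvar K i * h.
Proof.
move=> hf; exists (Germ (asboolT (convergent_shift i (asboolW (valP f))))).
apply: val_inj; apply: fpsP => m; rewrite -[RHS]/((gvar K i * _) m).
rewrite gcoef_varM; case mi: (m i) => [|c]; first exact: hf.
by rewrite /= submK // lep1mP mi.
Qed.

(** A germ with nonzero constant term is c (1 - w) with w vanishing at 0; its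
    inverse comes from substituting w into the geometric series. *)
Lemma germ_unitP u : reflect (u 0%MM != 0) (u \is a GRing.unit).
Proof.
apply: (iffP idP) => [/unitrP [v [vu _]]|u0].
  apply/eqP => u0; have := congr1 (fun f : germ K n => f 0%MM) vu.
  rewrite gcoef0M u0 mulr0 -[RHS]/((0%MM == 0%MM :> 'X_{1..n})%:R) eqxx.
  by move/eqP; rewrite eq_sym oner_eq0.
pose c := gconst n (u 0%MM)^-1; pose w : germ K n := 1 - c * u.
have c0 : c 0%MM = (u 0%MM)^-1 by rewrite /= eqxx.
have w0 i : tnth [tuple w] i 0%MM = 0.
  rewrite ord1 /w gcoefB gcoef0M c0 mulVf //.
  by rewrite -[X in X - _]/((0%MM == 0%MM :> 'X_{1..n})%:R) eqxx subrr.
pose G : germ K 1 := Germ (asboolT (convergent_geom K)).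
have GE : (1 - gvar K ord0) * G = 1.
  rewrite mulrBl mul1r; apply/eqP; rewrite subr_eq; apply/eqP.
  by apply: val_inj; apply: fpsgeomE.
have := congr1 (fun f : germ K 1 => gsubst f [tuple w]) GE.
rewrite /= gsubstM // gsubstB // gsubst1 // gsubst_var // {1}/w subKr => e.
apply/unitrP; exists (c * gsubst G [tuple w]).
by rewrite mulrAC e mulrA [u * c]mulrC e.
Qed.

End GermTheory.

(** * Germs in one variable: the valuation *)

Section OneVariable.
Variable K : numFieldType.
Implicit Types (u v : germ K 1).
Local Notation T := (gvar K (ord0 : 'I_1)).

Lemma mnm1_eq0 (m : 'X_{1..1}) : m ord0 = 0%N -> m = 0%MM.
Proof. by move=> m0; apply/mnmP => i; rewrite ord1 m0 mnm0E. Qed.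

Lemma germ1_factor u : u != 0 ->
  exists d v, u = T ^+ d * v /\ v 0%MM != 0.
Proof.
move=> un0; have [m um] : exists m, u m != 0.
  apply: contrapT => no; case/eqP: un0; apply: val_inj; apply: fpsP => m.
  by apply: contrapT => /eqP um; apply: no; exists m.
elim: {m}(mdeg m) {-2}m (erefl (mdeg m)) u um {un0} => [|d IHd] m md u um.
  by exists 0%N, u; rewrite expr0 mul1r; move/eqP: md; rewrite mdeg_eq0 => /eqP <-.
have [u0|u0] := eqVneq (u 0%MM) 0; last by exists 0%N, u; rewrite expr0 mul1r.
have [h uE] : exists h, u = T * h.
  by apply: gvar_dvd => m' /mnm1_eq0 ->.
move: um; rewrite uE gcoef_varM; case mi: (m ord0) => [|c] hm.
  by rewrite eqxx in hm.
have le : (U_(ord0) <= m)%MM by rewrite lep1mP mi.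
have [|e [v [hE v0]]] := IHd _ _ _ hm.
  by move: md; rewrite -{1}(submK le) mdegD mdeg1 addn1 => -[].
by exists e.+1, v; rewrite {1}hE exprS mulrA.
Qed.

Lemma fpsord_eq (f : fps K 1) m :
  vanish_below (mdeg m) f -> f m != 0 -> fpsord f = (mdeg m)%:Z%:E.
Proof.
move=> low fm; rewrite /fpsord; case: pselect => [ex|[]]; last first.
  by exists (mdeg m); apply/has_degreeP; exists m.
case: ex_minnP => d /has_degreeP [m' md' fm'] dmin; congr ((_ : int)%:E).
apply/eqP; rewrite eqz_nat eqn_leq dmin /=; last by apply/has_degreeP; exists m.
by rewrite leqNgt -md'; apply: contra fm' => lt; rewrite low.
Qed.

Lemma gord0 : gord (0 : germ K 1) = +oo%E.
Proof.
rewrite /gord /fpsord; case: pselect => // ex; exfalso.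
by case: ex => d /has_degreeP [m _ /eqP []].
Qed.

Lemma gord_factor d v : v 0%MM != 0 -> gord (T ^+ d * v) = d%:Z%:E.
Proof.
move=> v0; have coefd : (T ^+ d * v) (U_(ord0) *+ d)%MM = v 0%MM.
  elim: d => [|d IHd]; first by rewrite mulm0n expr0 mul1r.
  by rewrite exprS -mulrA gcoef_varM mulmS mnmDE mnm1E eqxx addmC addmK IHd.
have md : mdeg (U_(ord0) *+ d : 'X_{1..1})%MM = d by rewrite mdegMn mdeg1 mul1n.
rewrite /gord (@fpsord_eq _ (U_(ord0) *+ d)%MM) ?coefd ?md //.
elim: d {coefd md} => [m //|d IHd m lt]; rewrite exprS -mulrA gcoef_varM.
case mi: (m ord0) => [|c] //; apply: IHd.
have le : (U_(ord0) <= m)%MM by rewrite lep1mP mi.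
by move: lt; rewrite -{1}(submK le) mdegD mdeg1 addn1.
Qed.

Lemma gord_fin u : u != 0 -> exists d : nat, gord u = d%:Z%:E.
Proof.
by move=> /germ1_factor [d [v [-> v0]]]; exists d; rewrite gord_factor.
Qed.

Lemma gordM u v : gord (u * v) = (gord u + gord v)%E.
Proof.
have [->|] := eqVneq u 0.
  rewrite mul0r gord0; have [->|/gord_fin [d ->]] := eqVneq v 0 => //.
  by rewrite gord0.
move=> /germ1_factor [d [u' [-> u0]]].
have [->|] := eqVneq v 0; first by rewrite mulr0 gord0 gord_factor.
move=> /germ1_factor [e [v' [-> v0]]].
by rewrite mulrACA -exprD !gord_factor ?gcoef0M ?mulf_neq0 // PoszD.
Qed.

(** A nonzero germ is a power of t times a unit, and the powers of t are ordered
    by divisibility. *)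
Lemma gord_le_dvd u v : (gord v <= gord u)%E <-> exists w, u = w * v.
Proof.
split=> [|[w ->]]; last first.
  have [->|/gord_fin [d wd]] := eqVneq w 0; first by rewrite mul0r gord0 leey.
  rewrite gordM wd; have [->|/gord_fin [e ->]] := eqVneq v 0; first by rewrite gord0.
  by rewrite -EFinD lee_fin lerDr.
have [->|] := eqVneq u 0; first by exists 0; rewrite mul0r.
move=> /germ1_factor [d [u' [-> u0]]]; rewrite gord_factor //.
have [->|] := eqVneq v 0; first by rewrite gord0.
move=> /germ1_factor [e [v' [-> v0]]]; rewrite gord_factor // lee_fin lez_nat => le.
exists (T ^+ (d - e) * (u' * v'^-1)).
rewrite mulrACA -exprD subnK // -mulrA mulVr ?mulr1 //; exact/germ_unitP.
Qed.

Lemma mord_tofrac u : mord u%:F = gord u.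
Proof.
rewrite /mord; set r := repr _.
have d0 : \d_r != 0 by apply: denom_ratioP.
have nE : \n_r = u * \d_r.
  rewrite /r; unlock FracField.tofrac.
  by have := FracField.equivf_r (Ratio u 1); rewrite !numden_Ratio ?oner_eq0 // mul1r.
rewrite nE gordM; have [e ->] := gord_fin d0.
have [->|/gord_fin [d ->]] := eqVneq u 0; first by rewrite gord0.
by rewrite -EFinD addrK.
Qed.

Lemma gderiv_eq0 u : gderiv ord0 u = 0 -> u 0%MM = 0 -> u = 0.
Proof.
move=> du u0; apply: val_inj; apply: fpsP => m.
case mi: (m ord0) => [|c]; first by rewrite (mnm1_eq0 mi) u0.
have le : (U_(ord0) <= m)%MM by rewrite lep1mP mi.
have /eqP := congr1 (fun f : germ K 1 => f (m - U_(ord0))%MM) du.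
rewrite -[X in X == _]/(fpsderiv ord0 u _) fpsderivE submK // -mulr_natr mulf_eq0.
by rewrite pnatr_eq0 orbF => /eqP.
Qed.

End OneVariable.

(** * Ramification *)

Section MonomialSubst.
Variables (K : numFieldType) (n : nat).
Implicit Types (f : germ K n) (m : 'X_{1..n}).

Lemma gcoef_subst_diag (c : 'I_n -> K) (k : 'I_n -> nat)
    (g : n.-tuple (germ K n)) f m :
    (forall i, (0 < k i)%N) ->
    (forall i, tnth g i = gconst n (c i) * gvar K i ^+ k i) ->
  gsubst f g m =
    if [forall i, k i %| m i]%N then
      f [multinom (m i %/ k i)%N | i < n] * \prod_(i < n) c i ^+ (m i %/ k i)
    else 0.
Proof.
move=> k0 gE; apply: fpscoef_subst_diag => // i.
by rewrite tnth_map gE -[LHS]/(fpsC n (c i) * val (gvar K i ^+ k i)) rmorphXn.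
Qed.

Lemma gconst0 : gconst n 0 = 0 :> germ K n.
Proof. by apply: val_inj; apply: (rmorph0 (@fpsC K n)). Qed.

Lemma gconst1 : gconst n 1 = 1 :> germ K n.
Proof. by apply: val_inj; apply: (rmorph1 (@fpsC K n)). Qed.

Lemma gconstM a b : gconst n (a * b) = gconst n a * gconst n b :> germ K n.
Proof. by apply: val_inj; apply: (rmorphM (@fpsC K n)). Qed.

Lemma gcoef_subst_scale (c : 'I_n -> K) (g : n.-tuple (germ K n)) f m :
    (forall i, tnth g i = gconst n (c i) * gvar K i) ->
  gsubst f g m = f m * \prod_(i < n) c i ^+ m i.
Proof.
move=> gE; rewrite (@gcoef_subst_diag c (fun=> 1%N)) //.
rewrite ifT; last by apply/forallP => i; apply: dvd1n.
congr (f _ * _); first by apply/mnmP => i; rewrite mnmE divn1.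
by apply: eq_bigr => i _; rewrite divn1.
Qed.

Lemma gsubst_id (g : n.-tuple (germ K n)) f :
  (forall i, tnth g i = gvar K i) -> gsubst f g = f.
Proof.
move=> gE; apply: val_inj; apply: fpsP => m.
rewrite -[LHS]/(gsubst f g m) (@gcoef_subst_scale (fun=> 1)) => [|i].
  by rewrite big1 ?mulr1 // => i _; rewrite expr1n.
by rewrite gE gconst1 mul1r.
Qed.

Section Ramify.
Variables (k : 'I_n -> nat) (g : n.-tuple (germ K n)).
Hypotheses (k0 : forall i, (0 < k i)%N) (gE : forall i, tnth g i = gvar K i ^+ k i).

Lemma gcoef_ramify f m :
  gsubst f g m =
    if [forall i, k i %| m i]%N then f [multinom (m i %/ k i)%N | i < n] else 0.
Proof.
rewrite (@gcoef_subst_diag (fun=> 1) k) //; last by move=> i; rewrite gE gconst1 mul1r.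
by case: ifP => // _; rewrite big1 ?mulr1 // => i _; rewrite expr1n.
Qed.

Lemma ramify_inj : injective (fun f : germ K n => gsubst f g).
Proof.
move=> f h e; apply: val_inj; apply: fpsP => m; pose km := [multinom (k i * m i)%N | i < n].
have fkm (u : germ K n) : gsubst u g km = u m.
  rewrite gcoef_ramify ifT; last by apply/forallP => i; rewrite mnmE dvdn_mulr.
  by congr (gser u _); apply/mnmP => i; rewrite !mnmE mulKn.
by rewrite -[LHS]fkm -[RHS]fkm; congr (gser _ km).
Qed.

Lemma ramify_surj f : (forall m, f m != 0 -> forall i, (k i %| m i)%N) ->
  exists q, f = gsubst q g.
Proof.
move=> hf; exists (Germ (asboolT (convergent_contract k0 (asboolW (valP f))))).
apply: val_inj; apply: fpsP => m; rewrite -[RHS]/(gsubst _ g m) gcoef_ramify.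
case: forallP => [dv|ndv].
  by congr (gser f _); apply/mnmP => i; rewrite !mnmE mulnC divnK.
by apply: contrapT => /eqP /hf.
Qed.

End Ramify.

End MonomialSubst.

(** * Root factors of germs in two variables *)

Section Plane.
Variable K : numFieldType.
Local Notation X := (gvar K (ord0 : 'I_2)).
Local Notation Y := (gvar K (ord_max : 'I_2)).
Local Notation T := (gvar K (ord0 : 'I_1)).
Implicit Types (F G : germ K 2) (r x : germ K 1).

Lemma ord2P (i : 'I_2) : i = ord0 \/ i = ord_max.
Proof. by case: i => -[|[|//]] h; [left | right]; apply: val_inj. Qed.

Lemma pair_at0 k (a b : germ K k) :
  a 0%MM = 0 -> b 0%MM = 0 -> forall i, tnth [tuple a; b] i 0%MM = 0.
Proof. by move=> a0 b0 i; have [->|->] := ord2P i. Qed.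

Lemma single_at0 k (a : germ K k) :
  a 0%MM = 0 -> forall i, tnth [tuple a] i 0%MM = 0.
Proof. by move=> a0 i; rewrite fintype.ord1. Qed.

Lemma gsubst_pair k l F (a b : germ K k) (h : k.-tuple (germ K l)) :
    a 0%MM = 0 -> b 0%MM = 0 -> (forall i, tnth h i 0%MM = 0) ->
  gsubst (gsubst F [tuple a; b]) h = gsubst F [tuple gsubst a h; gsubst b h].
Proof.
move=> a0 b0 h0; rewrite gsubst_comp //; last exact: pair_at0.
by congr gsubst; apply: val_inj.
Qed.

Lemma gsubst_single k l r (a : germ K k) (h : k.-tuple (germ K l)) :
    a 0%MM = 0 -> (forall i, tnth h i 0%MM = 0) ->
  gsubst (gsubst r [tuple a]) h = gsubst r [tuple gsubst a h].
Proof.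
move=> a0 h0; rewrite gsubst_comp //; last exact: single_at0.
by congr gsubst; apply: val_inj.
Qed.

Lemma gsubst_pairX k (a b : germ K k) :
  a 0%MM = 0 -> b 0%MM = 0 -> gsubst X [tuple a; b] = a.
Proof. by move=> a0 b0; rewrite gsubst_var //; apply: pair_at0. Qed.

Lemma gsubst_pairY k (a b : germ K k) :
  a 0%MM = 0 -> b 0%MM = 0 -> gsubst Y [tuple a; b] = b.
Proof. by move=> a0 b0; rewrite gsubst_var //; apply: pair_at0. Qed.

Lemma gsubst_singleT k (a : germ K k) : a 0%MM = 0 -> gsubst T [tuple a] = a.
Proof. by move=> a0; rewrite gsubst_var //; apply: single_at0. Qed.

Definition in_Y r : germ K 2 := gsubst r [tuple Y].
Definition at_root F r : germ K 1 := gsubst F [tuple r; T].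

Let T0 : T 0%MM = 0 := gvar_coef0 K ord0.
Let X0 : X 0%MM = 0 := gvar_coef0 K ord0.
Let Y0 : Y 0%MM = 0 := gvar_coef0 K ord_max.

Lemma in_Y_coef0 r : in_Y r 0%MM = r 0%MM.
Proof. exact/gsubst_coef0/single_at0. Qed.

Lemma in_Y_pair k r (a b : germ K k) :
    a 0%MM = 0 -> b 0%MM = 0 ->
  gsubst (in_Y r) [tuple a; b] = gsubst r [tuple b].
Proof.
move=> a0 b0; rewrite gsubst_single ?gsubst_pairY //; exact: pair_at0.
Qed.

Lemma at_root_in_Y r x : x 0%MM = 0 -> at_root (in_Y r) x = r.
Proof.
by move=> x0; rewrite /at_root in_Y_pair // gsubst_id // => i; rewrite fintype.ord1.
Qed.

Lemma gderiv_in_Y r : gderiv ord0 (in_Y r) = 0.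
Proof.
rewrite gderiv_subst; last exact: single_at0.
by rewrite big_ord1 gderiv_var mulr0.
Qed.

(** The translation X -> X + r(Y) moves the root r to 0, where dividing by X - r
    becomes dividing by a variable. *)
Lemma root_dvd F r : r 0%MM = 0 -> at_root F r = 0 ->
  exists H, F = (X - in_Y r) * H.
Proof.
move=> r0 Fr; have ir0 : in_Y r 0%MM = 0 by rewrite in_Y_coef0.
have p0 : (X + in_Y r) 0%MM = 0 by rewrite gcoefD X0 ir0 addr0.
have m0 : (X - in_Y r) 0%MM = 0 by rewrite gcoefB X0 ir0 subr0.
pose G := gsubst F [tuple X + in_Y r; Y].
have G0 : gsubst G [tuple 0; Y] = 0.
  have h0 := pair_at0 (gcoef0 _ 0%MM) Y0.
  rewrite gsubst_pair // gsubstD // gsubst_pairX // gsubst_pairY // add0r.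
  rewrite in_Y_pair //; transitivity (in_Y (at_root F r)); last first.
    by rewrite Fr /in_Y gsubst0 //; apply: single_at0.
  rewrite /at_root /in_Y gsubst_pair ?gsubst_singleT //; exact: single_at0.
have [H GE] : exists H, G = X * H.
  apply: gvar_dvd => m mX; rewrite -[RHS](gcoef0 K m) -G0.
  rewrite (@gcoef_subst_scale _ _ (fun i => (i != ord0)%:R)) => [|i].
    rewrite big1 ?mulr1 // => i _; have [->|->] := ord2P i; first by rewrite mX.
    by rewrite expr1n.
  by have [->|->] := ord2P i; rewrite ?gconst0 ?gconst1 ?mul0r ?mul1r.
exists (gsubst H [tuple X - in_Y r; Y]).
have h0 := pair_at0 m0 Y0.
transitivity (gsubst G [tuple X - in_Y r; Y]).
  rewrite gsubst_pair // gsubstD // gsubst_pairX // gsubst_pairY // in_Y_pair //.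
  rewrite -/(in_Y r) subrK gsubst_id // => i.
  by have [->|->] := ord2P i.
by rewrite GE gsubstM // gsubst_pairX.
Qed.

Lemma at_rootM F G r : r 0%MM = 0 -> at_root (F * G) r = at_root F r * at_root G r.
Proof. by move=> r0; apply/gsubstM/pair_at0. Qed.

Lemma at_rootD F G r : r 0%MM = 0 -> at_root (F + G) r = at_root F r + at_root G r.
Proof. by move=> r0; apply/gsubstD/pair_at0. Qed.

Lemma at_rootB F G r : r 0%MM = 0 -> at_root (F - G) r = at_root F r - at_root G r.
Proof. by move=> r0; apply/gsubstB/pair_at0. Qed.

Lemma at_root_factor r x : x 0%MM = 0 -> at_root (X - in_Y r) x = x - r.
Proof.
by move=> x0; rewrite at_rootB // at_root_in_Y // /at_root gsubst_pairX.
Qed.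

Lemma gderiv_factor r : gderiv ord0 (X - in_Y r) = 1.
Proof. by rewrite gderivB gderiv_var gderiv_in_Y subr0. Qed.

Lemma factor_neq0 r : r 0%MM = 0 -> X - in_Y r != 0.
Proof.
move=> r0; apply/eqP => /(congr1 (fun F => gderiv ord0 F)).
rewrite gderiv_factor -[0 in RHS](subrr X) gderivB subrr.
by apply/eqP; rewrite oner_eq0.
Qed.

(** After dividing by X - r, the derivative at r becomes the value of the
    cofactor, which yields the second factor X - r; at another root r' the
    cofactor keeps its double zero because r' - r is nonzero in a domain. *)
Lemma double_roots_dvd (s : seq (germ K 1)) F :
    uniq s -> {in s, forall r : germ K 1, r 0%MM = 0} ->
    {in s, forall r, at_root F r = 0} ->
    {in s, forall r, at_root (gderiv ord0 F) r = 0} ->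
  exists Q, F = (\prod_(r <- s) (X - in_Y r)) ^+ 2 * Q.
Proof.
elim: s F => [|r s IHs] F; first by exists F; rewrite big_nil expr1n mul1r.
move=> /= /andP [rs us] s0 Fs dFs.
have r0 : r 0%MM = 0 by apply: s0; rewrite mem_head.
have [F1 FE] := root_dvd r0 (Fs r (mem_head _ _)).
have [F2 F1E] : exists F2, F1 = (X - in_Y r) * F2.
  apply: root_dvd => //; have := dFs r (mem_head _ _).
  rewrite FE gderivM gderiv_factor mul1r at_rootD // at_rootM //.
  by rewrite at_root_factor // subrr mul0r addr0.
have sub r' : r' \in s -> r' \in r :: s by rewrite inE orbC => ->.
have ne r' : r' \in s -> r' - r != 0.
  by move=> r's; rewrite subr_eq0; apply: contraNneq rs => <-.
have F2s : {in s, forall r', at_root F2 r' = 0}.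
  move=> r' r's; have r'0 := s0 _ (sub _ r's); have /eqP := Fs _ (sub _ r's).
  rewrite FE F1E !at_rootM // at_root_factor // !mulf_eq0 (negbTE (ne _ r's)) /=.
  by move=> /eqP.
have [|||Q F2E] := IHs F2 us; first by move=> r' /sub /s0.
- exact: F2s.
- move=> r' r's; have r'0 := s0 _ (sub _ r's); have /eqP := dFs _ (sub _ r's).
  rewrite FE F1E !gderivM gderiv_factor !mul1r at_rootD // !at_rootM // at_root_factor //.
  rewrite at_rootD // at_rootM // at_root_factor // F2s // mulr0 !add0r.
  rewrite !mulf_eq0 (negbTE (ne _ r's)) /=.
  by move=> /eqP.
by exists Q; rewrite FE F1E F2E big_cons exprMn expr2 !mulrA.
Qed.

End Plane.

(** * Descent along a ramified cover *)

Lemma exists_prim_root (C : numClosedFieldType) (n : nat) :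
  (0 < n)%N -> exists z : C, n.-primitive_root z.
Proof.
move=> n0; have [rs Dp] := closed_field_poly_normal ('X^n - 1 : {poly C}).
have {}Dp : 'X^n - 1 = \prod_(z <- rs) ('X - z%:P) :> {poly C}.
  by rewrite Dp (monicP (monicXnsubC 1 n0)) scale1r.
have sz : size rs = n by apply/succn_inj; rewrite -(size_prod_XsubC rs id) -Dp size_XnsubC.
have unity : all n.-unity_root rs.
  by apply/allP => z zrs; rewrite /root_of_unity Dp root_prod_XsubC.
have us : uniq rs.
  by rewrite -separable_prod_XsubC -Dp separable_Xn_sub_1 // pnatr_eq0 -lt0n.
have /hasP [z _ zn] := has_prim_root n0 unity us (eq_leq (esym sz)).
by exists z.
Qed.

Section Rotation.
Variables (K : numFieldType) (N : nat) (z : K).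
Hypotheses (N0 : (0 < N)%N) (zN : N.-primitive_root z).
Local Notation X := (gvar K (ord0 : 'I_2)).
Local Notation Y := (gvar K (ord_max : 'I_2)).
Local Notation T := (gvar K (ord0 : 'I_1)).
Implicit Types (F : germ K 2) (r x : germ K 1).

Definition ramify F : germ K 2 := gsubst F [tuple X; Y ^+ N].
Definition rotate1 r : germ K 1 := gsubst r [tuple gconst 1 z * T].
Definition rotate2 F : germ K 2 := gsubst F [tuple X; gconst 2 z * Y].

Let k (i : 'I_2) := if i == ord0 then 1%N else N.

Let k0 i : (0 < k i)%N.
Proof. by rewrite /k; case: ifP. Qed.

Let ramifyE i : tnth [tuple X; Y ^+ N] i = gvar K i ^+ k i.
Proof. by have [->|->] := ord2P i. Qed.

Let T0 : T 0%MM = 0 := gvar_coef0 K ord0.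
Let X0 : X 0%MM = 0 := gvar_coef0 K ord0.
Let Y0 : Y 0%MM = 0 := gvar_coef0 K ord_max.

Let expN0 l (u : germ K l) : u 0%MM = 0 -> (u ^+ N) 0%MM = 0.
Proof. by move=> u0; rewrite gcoef0Xn u0 expr0n -leqn0 leqNgt N0. Qed.

Let zT0 : (gconst 1 z * T) 0%MM = 0.
Proof. by rewrite gcoef0M T0 mulr0. Qed.

Let zY0 : (gconst 2 z * Y) 0%MM = 0.
Proof. by rewrite gcoef0M Y0 mulr0. Qed.

Let zexpN n (u : germ K n) : (gconst n z * u) ^+ N = u ^+ N.
Proof.
have cX e : gconst n z ^+ e = gconst n (z ^+ e).
  by elim: e => [|e IHe]; rewrite ?gconst1 // !exprS gconstM IHe.
by rewrite exprMn cX (prim_expr_order zN) gconst1 mul1r.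
Qed.

Lemma ramify_injective : injective ramify.
Proof. exact: ramify_inj k0 ramifyE. Qed.

Lemma ramify_coef0 F : ramify F 0%MM = F 0%MM.
Proof. exact/gsubst_coef0/pair_at0/expN0. Qed.

Lemma ramifyM F G : ramify (F * G) = ramify F * ramify G.
Proof. exact/gsubstM/pair_at0/expN0. Qed.

Lemma rotate2M F G : rotate2 (F * G) = rotate2 F * rotate2 G.
Proof. exact/gsubstM/pair_at0. Qed.

Lemma rotate2_ramify F : rotate2 (ramify F) = ramify F.
Proof.
have h := pair_at0 X0 zY0.
rewrite /rotate2 /ramify gsubst_pair ?expN0 // gsubstXn // gsubst_pairX //.
by rewrite gsubst_pairY // zexpN.
Qed.

(** Rotation multiplies the coefficient of X^i Y^j by z^j, so invariance leaves
    only the j divisible by N. *)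
Lemma rotate2_fixed F : rotate2 F = F -> exists G, F = ramify G.
Proof.
move=> rF; apply: (ramify_surj k0 ramifyE) => m Fm i.
rewrite /k; case: eqVneq => [_|ne]; first exact: dvd1n.
have -> : i = ord_max by case: (ord2P i) ne => ->.
have := congr1 (fun G : germ K 2 => G m) rF.
rewrite /rotate2 (@gcoef_subst_scale _ _ (fun i => if i == ord0 then 1 else z)) => [|j].
  rewrite big_ord_recl big_ord1 /= expr1n mul1r -[RHS]mulr1 => /(mulfI Fm) zm.
  rewrite (prim_order_dvd zN); apply/eqP; rewrite -[RHS]zm; congr (z ^+ m _).
  exact: val_inj.
by have [->|->] := ord2P j; rewrite ?gconst1 ?mul1r.
Qed.

Lemma rotate1_iter e x : iter e rotate1 x = gsubst x [tuple gconst 1 (z ^+ e) * T].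
Proof.
elim: e => [|e IHe].
  by rewrite expr0 gconst1 mul1r gsubst_id // => i; rewrite fintype.ord1.
rewrite iterS IHe /rotate1 gsubst_single ?gcoef0M ?T0 ?mulr0 //; last exact: single_at0.
rewrite gsubstM; last exact: single_at0.
rewrite gsubst_const; last exact: single_at0.
by rewrite gsubst_singleT // mulrA -gconstM -exprSr.
Qed.

Lemma rotate1_order x : iter N rotate1 x = x.
Proof.
rewrite rotate1_iter (prim_expr_order zN) gconst1 mul1r gsubst_id // => i.
by rewrite fintype.ord1.
Qed.

Lemma rotate1_inj : injective rotate1.
Proof.
move=> r s e; rewrite -(rotate1_order r) -(rotate1_order s).
by rewrite -(prednK N0) !iterSr e.
Qed.

Lemma rotate1_coef0 r : rotate1 r 0%MM = r 0%MM.
Proof. exact/gsubst_coef0/single_at0. Qed.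

Lemma rotate2_factor r : rotate2 (X - in_Y r) = X - in_Y (rotate1 r).
Proof.
have h := pair_at0 X0 zY0; rewrite /rotate2 gsubstB // gsubst_pairX //.
rewrite in_Y_pair // /in_Y /rotate1 gsubst_single //; last exact: single_at0.
rewrite gsubstM; last exact: single_at0.
rewrite gsubst_const; last exact: single_at0.
by rewrite gsubst_singleT.
Qed.

Lemma gsubst_branch_rotate F x : x 0%MM = 0 ->
  gsubst F (branch N (rotate1 x)) = rotate1 (gsubst F (branch N x)).
Proof.
move=> x0; have h := single_at0 zT0.
rewrite /rotate1 /branch gsubst_pair ?expN0 // gsubstXn // gsubst_singleT //.
by rewrite zexpN.
Qed.

Lemma at_root_ramify F r : r 0%MM = 0 -> at_root (ramify F) r = gsubst F (branch N r).
Proof.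
move=> r0; have h := pair_at0 r0 T0.
rewrite /at_root /ramify gsubst_pair ?expN0 // gsubstXn // gsubst_pairX //.
by rewrite gsubst_pairY.
Qed.

Lemma gderiv_ramify F : gderiv ord0 (ramify F) = ramify (df_dx F).
Proof.
rewrite gderiv_subst; last exact/pair_at0/expN0.
have dYN : gderiv ord0 (Y ^+ N) = 0.
  have dY e : gderiv ord0 (Y ^+ e.+1) = 0.
    elim: e => [|e IHe]; first by rewrite expr1 gderiv_var.
    by rewrite exprS gderivM gderiv_var IHe mul0r mulr0 addr0.
  by rewrite -(prednK N0).
rewrite big_ord_recl big_ord1 [tnth _ (lift _ _)]/(Y ^+ N) dYN mulr0 addr0.
by rewrite gderiv_var mulr1.
Qed.

(** The germ f(X, Y^N) splits off the factors X - r, with r ranging over the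
    distinct conjugates x(z^j t), each of them twice. Their product is invariant
    under rotation, so both it and the cofactor descend along Y -> Y^N. *)
Lemma double_branch f x :
    x 0%MM = 0 -> gsubst f (branch N x) = 0 -> gsubst (df_dx f) (branch N x) = 0 ->
  exists p q : germ K 2, p 0%MM = 0 /\ f = p ^+ 2 * q.
Proof.
move=> x0 fx dfx.
pose s := undup (traject rotate1 x N).
have sP r : r \in s -> exists2 e, (e < N)%N & r = iter e rotate1 x.
  by rewrite mem_undup => /trajectP [e lt ->]; exists e.
have x_e e : iter e rotate1 x 0%MM = 0.
  by elim: e => [|e IHe] //; rewrite iterS rotate1_coef0.
have s0 : {in s, forall r, r 0%MM = 0} by move=> r /sP [e _ ->].
have vanish h : gsubst h (branch N x) = 0 -> {in s, forall r, at_root (ramify h) r = 0}.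
  move=> hx r rs; rewrite at_root_ramify ?s0 //; have [e _ ->] := sP r rs.
  elim: e => [|e IHe] //; rewrite iterS gsubst_branch_rotate // IHe.
  exact/gsubst0/single_at0.
have [|Q fE] := double_roots_dvd (undup_uniq _) s0 (vanish _ fx).
  by rewrite gderiv_ramify; apply: vanish.
set p := \prod_(r <- s) _ in fE.
have p_neq0 : p != 0.
  by rewrite prodf_seq_neq0; apply/allP => r rs; apply/factor_neq0/s0.
have rp : rotate2 p = p.
  rewrite /p /rotate2 gsubst_prod; last exact: pair_at0.
  rewrite (eq_bigr (fun r => X - in_Y (rotate1 r))) => [|r _]; last exact: rotate2_factor.
  rewrite -(big_map rotate1 xpredT (fun r => X - in_Y r)); apply: perm_big.
  have us : uniq (map rotate1 s) by rewrite (map_inj_uniq rotate1_inj) undup_uniq.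
  apply: uniq_perm => //; first exact: undup_uniq.
  suff sub : {subset map rotate1 s <= s}.
    by have [_ eqs] := uniq_min_size us sub (eq_leq (esym (size_map _ _))).
  move=> _ /mapP [r /sP [e lt ->] ->]; rewrite mem_undup; apply/trajectP.
  have [eN|ne] := eqVneq e.+1 N; last by exists e.+1; rewrite // ltn_neqAle ne.
  by exists 0%N; rewrite // -iterS eN rotate1_order.
have rQ : rotate2 Q = Q.
  apply: (mulfI (expf_neq0 2 p_neq0)); rewrite -fE -[RHS]rotate2_ramify fE.
  by rewrite rotate2M expr2 rotate2M rp.
have [P pE] := rotate2_fixed rp; have [Q' QE] := rotate2_fixed rQ.
exists P, Q'; split; last first.
  by apply: ramify_injective; rewrite fE pE QE !ramifyM.
have xs : x \in s by rewrite mem_undup; apply/trajectP; exists 0%N.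
have [p' pxE] : exists p', p = (X - in_Y x) * p'.
  by exists (\prod_(r <- s | r != x) (X - in_Y r)); rewrite /p (bigD1_seq x) ?undup_uniq.
rewrite -ramify_coef0 -pE pxE gcoef0M gcoefB X0.
by rewrite in_Y_coef0 x0 subrr mul0r.
Qed.

End Rotation.

(** * Arcs on a reduced curve *)

(** The singularity of a reduced curve is isolated: along an arc where both
    partial derivatives vanish f is constant, hence 0, and then f has a square
    factor. *)
Lemma reduced_curve_smooth_arc (C : numClosedFieldType) (f : germ C 2) N (x : germ C 1) :
    reduced_curve f -> (0 < N)%N -> x 0%MM = 0 ->
    gsubst (df_dx f) (branch N x) = 0 -> gsubst (df_dy f) (branch N x) = 0 -> False.
Proof.
move=> [f_neq0 f0 red] N0 x0 fx0 fy0; have [z zN] := exists_prim_root C N0.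
have b0 : forall i, tnth (branch N x) i 0%MM = 0.
  by apply: pair_at0; rewrite // gcoef0Xn gvar_coef0 expr0n -leqn0 leqNgt N0.
have fx : gsubst f (branch N x) = 0.
  apply: gderiv_eq0; last by rewrite gsubst_coef0.
  rewrite gderiv_subst // big1 // => i _.
  by have [->|->] := ord2P i; rewrite ?fx0 ?fy0 mul0r.
have [p [q [p0 fE]]] := double_branch N0 zN x0 fx fx0.
have [|c pqE] := red (p * q) 2%N; first by exists q; rewrite fE exprMn [RHS]mulrCA -expr2.
have pq_neq0 : p * q != 0.
  by apply: contra_neq f_neq0 => pq0; rewrite fE expr2 -mulrA pq0 mulr0.
have cp : 1 = c * p.
  by apply: (mulIf pq_neq0); rewrite mul1r {1}pqE fE expr2 !mulrA.
have : p \is a GRing.unit by apply/unitrP; exists c; rewrite -cp mulrC -cp.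
by move/germ_unitP; rewrite p0 eqxx.
Qed.

(** * Doubles along a pair of branches *)

Lemma gen_submod_ind (A : nzRingType) (V : lmodType A) (S P : V -> Prop) :
    P 0 -> (forall u v, P u -> P v -> P (u + v)) ->
    (forall c u, P u -> P (c *: u)) -> (forall u, S u -> P u) ->
  forall v, gen_submod S v -> P v.
Proof.
move=> P0 PD PZ PS v [r [c [s [sS ->]]]].
by apply: (big_ind P) => // i _; apply/PZ/PS.
Qed.

(** The difference h(X, Y^N) - h(x2(Y), Y^N) has the root X = x2(Y); it remains to
    evaluate its factorization at X = x1(t). *)
Lemma gsubst_branch_dvd (K : numFieldType) (N : nat) (h : germ K 2) (x1 x2 : germ K 1) :
    (0 < N)%N -> x1 0%MM = 0 -> x2 0%MM = 0 ->
  exists w, gsubst h (branch N x1) - gsubst h (branch N x2) = w * (x1 - x2).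
Proof.
move=> N0 x10 x20; pose F := ramify N h; pose c := at_root F x2.
have [|H FE] := @root_dvd _ (F - in_Y c) x2 x20.
  by rewrite at_rootB // at_root_in_Y // subrr.
exists (at_root H x1); have := congr1 (fun G => at_root G x1) FE.
rewrite /= at_rootM // at_rootB // at_root_in_Y // at_root_factor // mulrC /c.
by rewrite !at_root_ramify.
Qed.

Section Pair.
Variables (K : numFieldType) (f : germ K 2) (a : K) (N : nat) (x1 x2 : germ K 1).
Hypotheses (N0 : (0 < N)%N) (x10 : x1 0%MM = 0) (x20 : x2 0%MM = 0).
Hypotheses (polar1 : gsubst (polar f a) (branch N x1) = 0)
           (polar2 : gsubst (polar f a) (branch N x2) = 0).

Local Notation phi1 := (branch N x1).
Local Notation phi2 := (branch N x2).
Local Notation Phi := (cat_tuple phi1 phi2).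
Local Notation u1 := (gsubst (df_dy f) phi1).
Local Notation u2 := (gsubst (df_dy f) phi2).

Lemma branch_at0 (x : germ K 1) :
  x 0%MM = 0 -> forall i, tnth (branch N x) i 0%MM = 0.
Proof.
move=> x0; apply: pair_at0; rewrite // gcoef0Xn gvar_coef0 expr0n.
by rewrite -leqn0 leqNgt N0.
Qed.

Let phi10 := branch_at0 x10.
Let phi20 := branch_at0 x20.

Lemma Phi_at0 i : tnth Phi i 0%MM = 0.
Proof. by case: (split_ordP i) => j ->; rewrite ?tnth_lshift ?tnth_rshift. Qed.

Lemma pullback2_double h :
  pullback2 Phi (germ_double h) = (gsubst h phi1, gsubst h phi2).
Proof.
rewrite /pullback2 /germ_double /=.
have var0 (i : 'I_(2 + 2)) : gvar K i 0%MM = 0 by exact: gvar_coef0.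
rewrite !gsubst_comp; try exact: Phi_at0; try by move=> i; rewrite tnth_mktuple.
by congr (_, _); congr gsubst; apply: eq_from_tnth => i;
   rewrite tnth_map tnth_mktuple gsubst_var ?tnth_lshift ?tnth_rshift //; apply: Phi_at0.
Qed.

Lemma df_dx_branch (x : germ K 1) : x 0%MM = 0 ->
    gsubst (polar f a) (branch N x) = 0 ->
  gsubst (df_dx f) (branch N x) = gconst 1 a * gsubst (df_dy f) (branch N x).
Proof.
move=> /branch_at0 b0; rewrite /polar gsubstB // gsubstM // gsubst_const //.
by move/eqP; rewrite subr_eq0 => /eqP.
Qed.

(** After division by (u1, u2), this is the fibre product of two copies of O_1
    over O_1 / (x1 - x2). *)
Definition balanced (v : germ2 K 1) : Prop :=
  exists k1 k2, [/\ v.1 = k1 * u1, v.2 = k2 * u2 & exists w, k1 - k2 = w * (x1 - x2)].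

Lemma balanced0 : balanced 0.
Proof. by exists 0, 0; rewrite !mul0r; split=> //; exists 0; rewrite subrr mul0r. Qed.

Lemma balancedD v v' : balanced v -> balanced v' -> balanced (v + v').
Proof.
move=> [k1 [k2 [e1 e2 [w e]]]] [k1' [k2' [e1' e2' [w' e']]]].
exists (k1 + k1'), (k2 + k2'); split; rewrite ?mulrDl -?(e1, e2, e1', e2') //.
by exists (w + w'); rewrite mulrDl -e -e' opprD addrACA.
Qed.

Lemma balancedZ c v : balanced v -> balanced (c *: v).
Proof.
move=> [k1 [k2 [e1 e2 [w e]]]]; exists (c * k1), (c * k2).
split; rewrite -?mulrA -?e1 -?e2 //.
by exists (c * w); rewrite -mulrA -e mulrBr.
Qed.

Lemma jacobian_ideal_branches h : jacobian_ideal f h ->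
  exists k, gsubst h phi1 = gsubst k phi1 * u1 /\ gsubst h phi2 = gsubst k phi2 * u2.
Proof.
have dx1 := df_dx_branch x10 polar1; have dx2 := df_dx_branch x20 polar2.
move: h; apply: (@gen_submod_ind _ (germ K 2)^o _ (fun h => exists k : germ K 2,
  gsubst h phi1 = gsubst k phi1 * u1 /\ gsubst h phi2 = gsubst k phi2 * u2))
    => [|h h' [k [e1 e2]] [k' [e1' e2']]|c h' [k [e1 e2]]|h' [->|->]].
- by exists 0; rewrite !gsubst0 // !mul0r.
- by exists (k + k'); rewrite !gsubstD // !mulrDl e1 e2 e1' e2'.
- by exists (c * k); rewrite -[_ *: _]/(c * h') !gsubstM // e1 e2 !mulrA.
- by exists (gconst 2 a); rewrite !gsubst_const.
- by exists 1; rewrite !gsubst1 // !mul1r.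
Qed.

Lemma pullback_balanced v :
  pullback_submod Phi (jacobian_double f) v -> balanced v.
Proof.
move: v; apply: (@gen_submod_ind _ (germ2 K 1) _ balanced) => [|u w|c u|u].
- exact: balanced0.
- exact: balancedD.
- exact: balancedZ.
move=> [w Jw ->] {u}; move: w Jw.
have P0 := Phi_at0.
apply: (@gen_submod_ind _ (germ2 K (2 + 2)) _ (fun w => balanced (pullback2 Phi w))).
- by rewrite /pullback2 /= !gsubst0 //; apply: balanced0.
- move=> u v bu bv; have -> : pullback2 Phi (u + v) = pullback2 Phi u + pullback2 Phi v.
    by rewrite /pullback2 /= !gsubstD.
  exact: balancedD.
- move=> c u bu; have -> : pullback2 Phi (c *: u) = gsubst c Phi *: pullback2 Phi u.
    by rewrite /pullback2 /= !gsubstM.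
  exact: balancedZ.
- move=> _ [h /jacobian_ideal_branches [k [e1 e2]] ->]; rewrite pullback2_double.
  exists (gsubst k phi1), (gsubst k phi2); split=> //; exact: gsubst_branch_dvd.
Qed.

(** The doubles of f_y and of x f_y pull back to (u1, u2) and (x1 u1, x2 u2),
    which span (k2 u1, k2 u2) + ((x1 - x2) w u1, 0). *)
Lemma balanced_pullback v :
  balanced v -> pullback_submod Phi (jacobian_double f) v.
Proof.
move=> [k1 [k2 [e1 e2 [w e]]]].
have fyJ : jacobian_ideal f (df_dy f).
  exists 1%N, (fun=> 1), (fun=> df_dy f); split; first by right.
  by rewrite big_ord1 scale1r.
have xfyJ : jacobian_ideal f (gvar K ord0 * df_dy f).
  exists 1%N, (fun=> gvar K ord0), (fun=> df_dy f); split; first by right.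
  by rewrite big_ord1.
pose h (i : 'I_2) := if i == ord0 then df_dy f else gvar K ord0 * df_dy f.
exists 2%N, (fun i => if i == ord0 then k2 - w * x2 else w),
  (fun i => pullback2 Phi (germ_double (h i))); split=> [i|].
  exists (germ_double (h i)) => //.
  exists 1%N, (fun=> 1), (fun=> germ_double (h i)).
  split; last by rewrite big_ord1 scale1r.
  by move=> _; exists (h i); rewrite // /h; case: ifP.
rewrite big_ord_recl big_ord1 /h /= !pullback2_double.
rewrite (gsubstM phi10) (gsubstM phi20) (gsubst_var phi10) (gsubst_var phi20).
rewrite [LHS]surjective_pairing e1 e2; congr (_, _).
  transitivity ((k2 - w * x2) * u1 + w * (x1 * u1)) => //.
  by rewrite mulrA -mulrDl -addrA -mulrN -mulrDr [- x2 + x1]addrC -e addrC subrK.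
transitivity ((k2 - w * x2) * u2 + w * (x2 * u2)) => //.
by rewrite mulrA -mulrDl subrK.
Qed.

End Pair.

Lemma holomorphic_div (K : numFieldType) (u v : germ K 1) :
  v != 0 -> holomorphic (u%:F / v%:F) <-> exists k, u = k * v.
Proof.
move=> v0; have vF : v%:F != 0 by rewrite tofrac_eq0.
split=> [[k e]|[k ->]]; exists k; last by rewrite tofracM mulfK.
by apply/eqP; rewrite -tofrac_eq tofracM -e divfK.
Qed.

Theorem proposition3p6 (R : realType) (f g : germ R[i] 2) (a : R[i]) (N : nat)
    (x1 x2 : germ R[i] 1) :
    reduced_curve f ->
    is_branch (polar f a) N x1 -> is_branch (polar f a) N x2 ->
  let phi1 := branch N x1 in
  let phi2 := branch N x2 in
  let Phi := cat_tuple phi1 phi2 in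
  let q1 := (gsubst g phi1)%:F / (gsubst (df_dy f) phi1)%:F in
  let q2 := (gsubst g phi2)%:F / (gsubst (df_dy f) phi2)%:F in
  pullback_submod Phi (jacobian_double f) (pullback2 Phi (germ_double g)) <->
  [/\ holomorphic q1, holomorphic q2 & (contact x1 x2 <= mord (q1 - q2)%R)%E].
Proof.
move=> red [N0 x10 pol1] [_ x20 pol2] phi1 phi2 Phi q1 q2.
have dx1 := df_dx_branch N0 x10 pol1; have dx2 := df_dx_branch N0 x20 pol2.
have u1_neq0 : gsubst (df_dy f) phi1 != 0.
  apply/eqP => u10; apply: (reduced_curve_smooth_arc red N0 x10) => //.
  by rewrite dx1 u10 mulr0.
have u2_neq0 : gsubst (df_dy f) phi2 != 0.
  apply/eqP => u20; apply: (reduced_curve_smooth_arc red N0 x20) => //.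
  by rewrite dx2 u20 mulr0.
have qE (u k v : germ R[i] 1) : v != 0 -> u = k * v -> u%:F / v%:F = k%:F.
  by move=> v0 ->; rewrite tofracM mulfK ?tofrac_eq0.
have pb := pullback2_double N0 x10 x20 g.
split=> [/(pullback_balanced N0 x10 x20 pol1 pol2)|[h1 h2 le]].
  rewrite pb => -[k1 [k2 [e1 e2 dvd]]].
  have q1E := qE _ _ _ u1_neq0 e1; have q2E := qE _ _ _ u2_neq0 e2.
  split; [by exists k1|by exists k2|].
  by rewrite /q1 /q2 q1E q2E -tofracB mord_tofrac; apply/gord_le_dvd.
apply: balanced_pullback => //; rewrite pb.
have [k1 e1] := (holomorphic_div _ u1_neq0).1 h1.
have [k2 e2] := (holomorphic_div _ u2_neq0).1 h2.
exists k1, k2; split=> //; apply/gord_le_dvd.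
move: le; rewrite /q1 /q2 (qE _ _ _ u1_neq0 e1) (qE _ _ _ u2_neq0 e2).
by rewrite -tofracB mord_tofrac.
Qed.
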